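(* Let $(x,0),(-x,u)\in\mathbb{R}^n\times\mathbb{R}$ with $x\neq0$ and $u>0$. Put $\tilde\mu(s)=\frac{s}{\sin^2s}-\cot s$ for $s\in\mathbb{R}$ not a nonzero integer multiple of $\pi$ (with $\tilde\mu(0)=0$, by continuity). There are finitely many geodesics connecting $(x,0)$ and $(-x,u)$. Namely: 1. For any solution $b$ of $$\frac{u}{|x|^2}=\tilde\mu\left(\frac b2\right)$$ there is a geodesic $\gamma^b$ with square of length $$L(\gamma^b)^2=\frac{b^2}{\sin^2\frac b2}|x|^2=2bu+2|x|^2b\cot\frac b2,$$ which strictly increases with $b$. 2. If $2u\ge|x|^2\pi$, then for each integer $m\ge0$ with $2u\ge(2m+1)\pi|x|^2$ there are geodesics $\gamma^{b,c}$ with $b=(2m+1)\pi$, $|c|=\sqrt{2(2m+1)\pi u-(2m+1)^2\pi^2|x|^2}$ and lengths $$L(\gamma^{b,c})=\sqrt{2(2m+1)\pi u}.$$ Moreover, if $2u<|x|^2\pi$, the shortest geodesic, and therefore the Carnot–Carathéodory distance, is given by the unique solution $b$ of $\frac{u}{|x|^2}=\tilde\mu\left(\frac b2\right)$ in the interval $(0,\pi)$; with this $b$ we have $$d_{CC}\left((x,0),(-x,u)\right)=\frac{b}{\sin\frac b2}|x|=\sqrt{2bu+2|x|^2b\cot\frac b2}.$$ And if $2u\ge|x|^2\pi$, then the Carnot–Carathéodory distance is given by $$d_{CC}\left((x,0),(-x,u)\right)=\sqrt{2\pi u}.$$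
   Context: On $\mathbb{R}^{n+1}=\mathbb{R}^n_x\times\mathbb{R}_u$ consider the vector fields $X_j=\partial_{x_j}$, $U_j=x_j\partial_u$ ($j=1,\dots,n$). For $p\in\mathbb{R}^{n+1}$ and a tangent vector $v$ at $p$ put $\|v\|_p^2=\inf\{\sum_{j=1}^n(\alpha_j^2+\beta_j^2): v=\sum_{j=1}^n(\alpha_jX_j(p)+\beta_jU_j(p))\}$, with $\inf\varnothing=\infty$. A horizontal curve is an absolutely continuous curve $\gamma:[0,1]\to\mathbb{R}^{n+1}$ with $\dot\gamma(t)\in\mathrm{span}\{X_j(\gamma(t)),U_j(\gamma(t)):1\le j\le n\}$ for almost every $t$; its length is $L(\gamma)=\int_0^1\|\dot\gamma(t)\|_{\gamma(t)}\,dt$. The Carnot–Carathéodory distance $d_{CC}(p,q)$ is the infimum of $L(\gamma)$ over all horizontal curves $\gamma$ with $\gamma(0)=p$, $\gamma(1)=q$. Geodesics are the solutions of the Euler–Lagrange equations of the energy $\int_0^1\|\dot\gamma\|_\gamma^2dt$. The geodesics starting at $(x_1,0)$ are the curves $\gamma^{b,c}=(\gamma^{b,c}_{(1)},\gamma^{b,c}_{(2)}):[0,1]\to\mathbb{R}^n\times\mathbb{R}$ with parameters $b\in\mathbb{R}$, $c\in\mathbb{R}^n$, where for $b\neq0$ $$\gamma^{b,c}_{(1)}(t)=\frac cb\sin(bt)+x_1\cos(bt),$$ $$\gamma^{b,c}_{(2)}(t)=\frac{|c|^2}{b}\left(\frac t2-\frac{\sin(2bt)}{4b}\right)+\frac{x_1\cdot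 c}{b}\sin^2(bt)+|x_1|^2b\left(\frac t2+\frac{\sin(2bt)}{4b}\right),$$ and $\gamma^{0,c}(t)=(ct+x_1,0)$. Their length is $L(\gamma^{b,c})=\sqrt{|c|^2+|x_1|^2b^2}$. Here $x_1=x$, and a geodesic connects $(x,0)$ and $(-x,u)$ if $\gamma^{b,c}(1)=(-x,u)$. When $b$ is not a nonzero integer multiple of $\pi$, the endpoint condition determines $c$ uniquely, namely $c=\frac{b}{\sin b}(-x-x\cos b)=-b\cot\left(\frac b2\right)x$, and $\gamma^b$ denotes the geodesic $\gamma^{b,c}$ with this $c$ (where $b$ is an odd multiple of $\pi$, $c=-b\cot\left(\frac b2\right)x=0$).
   Formalization: ''Finitely many geodesics'' fails for n≥2 and 2u>π|x|² (item 2 with m=0 gives a whole sphere of c); it is proved literally when n=1 or 2u≤π|x|², and otherwise as completeness of the list and finitely many pairs (b,|c|). *)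

(* Defs.v *)
From HB Require Import structures.
From mathcomp Require Export all_boot all_order all_algebra.
From mathcomp Require Export all_classical all_reals all_analysis.

Set Implicit Arguments.
Unset Strict Implicit.
Unset Printing Implicit Defensive.

Export Order.TTheory GRing.Theory Num.Theory.
Export numFieldNormedType.Exports.

Open Scope classical_set_scope.
Open Scope ring_scope.

(* The library norm `|x| on row vectors is the sup norm; dot and enorm are the
   Euclidean inner product and norm. *)
Definition dot (R : realType) (n : nat) (x y : 'rV[R]_n) : R :=
  \sum_(j < n) x 0 j * y 0 j.

Definition enorm (R : realType) (n : nat) (x : 'rV[R]_n) : R :=
  Num.sqrt (dot x x).

(* R^{n+1} = R^n_x * R_u; tangent vectors live in the same type. *)
Notation space R n := ('rV[R]_n * R)%type.

Definition vfX (R : realType) (n : nat) (j : 'I_n) (p : space R n) : space R n :=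
  (delta_mx 0 j, 0).

Definition vfU (R : realType) (n : nat) (j : 'I_n) (p : space R n) : space R n :=
  (0, p.1 0 j).

Definition hcomb (R : realType) (n : nat) (p : space R n) (a b : 'rV[R]_n) :
    space R n :=
  \sum_(j < n) (a 0 j *: vfX j p + b 0 j *: vfU j p).

Definition in_hspan (R : realType) (n : nat) (p v : space R n) : Prop :=
  exists a b : 'rV[R]_n, v = hcomb p a b.

(* ereal_inf set0 = +oo, as required for non-horizontal v. *)
Definition cc_sqnorm (R : realType) (n : nat) (p v : space R n) : \bar R :=
  ereal_inf [set (\sum_(j < n) (ab.1 0 j ^+ 2 + ab.2 0 j ^+ 2))%:E
            | ab in [set ab : 'rV[R]_n * 'rV[R]_n | v = hcomb p ab.1 ab.2]].

Definition cc_norm (R : realType) (n : nat) (p v : space R n) : \bar R :=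
  sqrte (cc_sqnorm p v).

(* Curves are total functions on R of which only the restriction to [0, 1]
   matters. *)
Definition abs_continuous01 (R : realType) (V : normedModType R) (g : R -> V) :
    Prop :=
  forall e : R, 0 < e -> exists2 d : R, 0 < d &
    forall (m : nat) (s t : 'I_m -> R),
      (forall i, [/\ 0 <= s i, s i <= t i & t i <= 1]) ->
      trivIset setT (fun i => `]s i, t i[%classic) ->
      \sum_(i < m) (t i - s i) < d ->
      \sum_(i < m) `|g (t i) - g (s i)| < e.

Definition horizontal (R : realType) (n : nat) (g : R -> space R n) : Prop :=
  abs_continuous01 g /\
  {ae lebesgue_measure, forall t : R, t \in `[0, 1] ->
     derivable g t 1 /\ in_hspan (g t) (derive1 g t)}.

Definition cc_length (R : realType) (n : nat) (g : R -> space R n) : \bar R :=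
  (\int[lebesgue_measure]_(t in `[0%R, 1%R]) cc_norm (g t) (derive1 g t))%E.

Definition connects (R : realType) (n : nat) (p q : space R n)
    (g : R -> space R n) : Prop :=
  g 0 = p /\ g 1 = q.

Definition cc_dist (R : realType) (n : nat) (p q : space R n) : \bar R :=
  ereal_inf [set cc_length g | g in [set g | horizontal g /\ connects p q g]].

(* Euler-Lagrange equations of the energy int |x'|^2 + |beta|^2 of a curve
   (x, u) with controls alpha = x' and beta, under the constraint
   u' = beta . x.  With the Lagrangian
     (|x'|^2 + |beta|^2) / 2 + lambda (u' - beta . x)
   they read lambda' = 0 (in u), beta = lambda x (in beta) and
   x'' = - lambda beta (in x).  Where x <> 0 the squared norm of (x', u') is
   |x'|^2 + u'^2 / |x|^2 and these are its Euler-Lagrange equations, with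
   lambda = u' / |x|^2; in this form they also make sense where x = 0. *)
Definition geodesic (R : realType) (n : nat) (g : R -> space R n) : Prop :=
  {within `[0, 1], continuous g} /\
  exists (lambda : R) (beta : R -> 'rV[R]_n), forall t : R, t \in `]0, 1[ ->
    [/\ derivable g t 1,
        derivable (fun s => (derive1 g s).1) t 1,
        (derive1 g t).2 = dot (beta t) (g t).1,
        beta t = lambda *: (g t).1 &
        derive1 (fun s => (derive1 g s).1) t = - (lambda *: beta t)].

Definition geodesics (R : realType) (n : nat) (p q : space R n) :
    set (R -> space R n) :=
  [set g | geodesic g /\ connects p q g].

Definition gamma (R : realType) (n : nat) (x : 'rV[R]_n) (b : R) (c : 'rV[R]_n)
    (t : R) : space R n :=
  if b == 0 then (t *: c + x, 0)
  else ((sin (b * t) / b) *: c + cos (b * t) *: x,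
        enorm c ^+ 2 / b * (t / 2 - sin (2 * b * t) / (4 * b))
        + dot x c / b * sin (b * t) ^+ 2
        + enorm x ^+ 2 * b * (t / 2 + sin (2 * b * t) / (4 * b))).

Definition cot (R : realType) (s : R) : R := cos s / sin s.

(* The geodesic gamma^b; only used for b not a multiple of 2 pi. *)
Definition gamma_cot (R : realType) (n : nat) (x : 'rV[R]_n) (b : R) :
    R -> space R n :=
  gamma x b (- (b * cot (b / 2)) *: x).

Definition mu_tilde (R : realType) (s : R) : R :=
  if s == 0 then 0 else s / sin s ^+ 2 - cot s.

Definition mu_dom (R : realType) (s : R) : Prop :=
  forall k : int, k != 0 -> s <> k%:~R * pi.

(* b solves u / |x|^2 = mu_tilde (b / 2). *)
Definition mu_solution (R : realType) (n : nat) (x : 'rV[R]_n) (u b : R) : Prop :=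
  mu_dom (b / 2) /\ u / enorm x ^+ 2 = mu_tilde (b / 2).

Definition eq01 (R : realType) (n : nat) (g h : R -> space R n) : Prop :=
  forall t : R, t \in `[0, 1] -> g t = h t.

(* Main.v *)
Require Import Defs.
From mathcomp Require Import measurable_realfun ring lra.

(* Along a geodesic from (x, 0) the point oscillates harmonically in R^n, so the
   curves gamma^{b,c} are all the geodesics, and the end condition either forces
   c = - b cot(b/2) x with s = b/2 a root of s = a sin^2 s + sin s cos s, where
   a = u / |x|^2, or makes b an odd multiple of pi.  Rolle's theorem bounds the
   number of roots.

   Lower bound on the distance: for 0 < b < pi let S(tau, y, v) be the solution
   of the Hamilton-Jacobi equation S_tau + |S_y|^2 / 4 + b^2 |y|^2 = 0, plus
   2 b v, that is quadratic in y and whose increment between (0, x, 0) and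
   (1, - x, u) is 2 b u + 2 |x|^2 b cot(b/2).  Along a horizontal curve of length
   L, with tau the arc length divided by L, S grows at rate at most
   |g'|^2 / tau' = L^2 tau', hence L^2 >= 2 b u + 2 |x|^2 b cot(b/2).  For
   2 u < pi |x|^2 the root b gives equality; otherwise let b tend to pi. *)

(** The bound 2 b u + 2 |x|^2 b cot(b/2) has b-derivative 2 |x|^2 (u/|x|^2 - mu_tilde(b/2)): the
    equation for b expresses that the best calibration is chosen, and there the bound equals the
    squared length of gamma^b. As mu_tilde(pi/2) = pi/2, no stationary point is left in (0, pi) once
    2 u >= pi |x|^2, and the best bound is the limit 2 pi u. It has to be a limit, because at b = pi
    the coefficients of S have poles at tau = 0 and tau = 1. A competing curve is only absolutely
    continuous and may cross x = 0, where the norm degenerates. S is polynomial in (y, v), hence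
    smooth there, and the growth estimate needs only that an absolutely continuous function whose
    derivative is nonpositive almost everywhere does not increase. Past b = 2 pi the function
    mu_tilde(b/2) is not monotone and the equation can have several solutions, so their lengths are
    compared algebraically from two root equations, not along a branch. *)

Set Implicit Arguments.
Unset Strict Implicit.
Unset Printing Implicit Defensive.

(** * Euclidean products, derivatives, trigonometry *)

Section dot.
Variables (R : realType) (n : nat).
Implicit Types (x y z : 'rV[R]_n) (k : R).

Lemma dotC x y : dot x y = dot y x.
Proof. by apply: eq_bigr => j _; rewrite mulrC. Qed.

Lemma dotDl x y z : dot (x + y) z = dot x z + dot y z.
Proof.
by rewrite /dot -big_split/=; apply: eq_bigr => j _; rewrite !mxE mulrDl.
Qed.

Lemma dotZl k x y : dot (k *: x) y = k * dot x y.
Proof. by rewrite /dot mulr_sumr; apply: eq_bigr => j _; rewrite !mxE mulrA. Qed.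

Lemma dotDr x y z : dot x (y + z) = dot x y + dot x z.
Proof. by rewrite dotC dotDl !(dotC x). Qed.

Lemma dotZr k x y : dot x (k *: y) = k * dot x y.
Proof. by rewrite dotC dotZl dotC. Qed.

Lemma dotNl x y : dot (- x) y = - dot x y.
Proof. by rewrite -scaleN1r dotZl mulN1r. Qed.

Lemma dotNr x y : dot x (- y) = - dot x y.
Proof. by rewrite dotC dotNl dotC. Qed.

Lemma dot0l x : dot 0 x = 0.
Proof. by rewrite -(scale0r 0) dotZl mul0r. Qed.

Lemma dot_ge0 x : 0 <= dot x x.
Proof. by apply: sumr_ge0 => j _; rewrite -expr2 sqr_ge0. Qed.

Lemma dot_eq0 x : (dot x x == 0) = (x == 0).
Proof.
apply/idP/eqP => [|->]; last by rewrite dot0l.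
rewrite psumr_eq0 => [/allP x0|j _]; last by rewrite -expr2 sqr_ge0.
apply/rowP => j; rewrite mxE; apply/eqP.
by have := x0 j (mem_index_enum j); rewrite /= -expr2 sqrf_eq0.
Qed.

Lemma dot_gt0 x : x != 0 -> 0 < dot x x.
Proof. by rewrite -dot_eq0 lt_neqAle dot_ge0 andbT eq_sym. Qed.

Lemma enorm_sqr x : enorm x ^+ 2 = dot x x.
Proof. by rewrite sqr_sqrtr// dot_ge0. Qed.

Lemma enorm_ge0 x : 0 <= enorm x.
Proof. exact: sqrtr_ge0. Qed.

Lemma enorm_gt0 x : x != 0 -> 0 < enorm x.
Proof. by move=> x0; rewrite sqrtr_gt0 dot_gt0. Qed.

Lemma enormZ k x : enorm (k *: x) = `|k| * enorm x.
Proof.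
by rewrite /enorm dotZl dotZr mulrA -expr2 sqrtrM ?sqr_ge0// sqrtr_sqr.
Qed.

Lemma enorm_eq0 x : enorm x = 0 -> x = 0.
Proof. by move=> x0; apply/eqP; rewrite -dot_eq0 -enorm_sqr x0 expr0n. Qed.

End dot.

Section is_derive_pointwise.
Variable R : realType.
Implicit Types (f g : R -> R) (x : R).

Lemma is_derive_addf f g x df dg : is_derive x 1 f df -> is_derive x 1 g dg ->
  is_derive x 1 (fun t => f t + g t) (df + dg).
Proof. exact: is_deriveD. Qed.

Lemma is_derive_oppf f x df : is_derive x 1 f df ->
  is_derive x 1 (fun t => - f t) (- df).
Proof. exact: is_deriveN. Qed.

Lemma is_derive_mulf f g x df dg : is_derive x 1 f df -> is_derive x 1 g dg ->
  is_derive x 1 (fun t => f t * g t) (df * g x + f x * dg).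
Proof.
move=> hf hg; have := is_deriveM hf hg.
by rewrite /GRing.scale/= addrC (mulrC (g x)).
Qed.

Lemma is_derive_sqrf f x df : is_derive x 1 f df ->
  is_derive x 1 (fun t => f t ^+ 2) (2 * f x * df).
Proof. by move=> hf; have := is_deriveX 2 hf; rewrite expr1. Qed.

Lemma is_derive_sinf f x df : is_derive x 1 f df ->
  is_derive x 1 (fun t => sin (f t)) (cos (f x) * df).
Proof. by move=> hf; apply: (is_derive1_comp _ hf). Qed.

Lemma is_derive_cosf f x df : is_derive x 1 f df ->
  is_derive x 1 (fun t => cos (f t)) (- sin (f x) * df).
Proof. by move=> hf; apply: (is_derive1_comp _ hf). Qed.

Lemma is_derive_invf f x df : f x != 0 -> is_derive x 1 f df ->
  is_derive x 1 (fun t => (f t)^-1) (- df / f x ^+ 2).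
Proof.
move=> fx0 [dfx <-]; have dV := derivableV fx0 dfx.
apply: (@DeriveDef _ _ _ _ _ (fun t => (f t)^-1)) => //.
by rewrite deriveV// /GRing.scale/= mulNr mulrC mulNr.
Qed.

Lemma is_derive_idf x : is_derive x 1 (fun t : R => t) 1.
Proof. exact: is_derive_id. Qed.

Lemma is_derive_cstf (a x : R) : is_derive x 1 (fun _ : R => a) 0.
Proof. exact: is_derive_cst. Qed.

End is_derive_pointwise.

(** The derivative may be an evar, which the rules instantiate; [eassumption] supplies the
    derivatives of abstract functions. *)
Ltac is_derive_tac :=
  first [ exact: is_derive_cstf | exact: is_derive_idf | eassumption
        | apply: is_derive_addf; is_derive_tac
        | apply: is_derive_oppf; is_derive_tac
        | apply: is_derive_mulf; is_derive_tac
        | apply: is_derive_sqrf; is_derive_tac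
        | apply: is_derive_sinf; is_derive_tac
        | apply: is_derive_cosf; is_derive_tac ].

Lemma is_derive_continuous (R : realType) (f : R -> R) (x df : R) :
  is_derive x 1 f df -> {for x, continuous f}.
Proof.
by case=> + _ => /derivable1_diffP; exact: differentiable_continuous.
Qed.

Lemma derive1_val (R : realType) (V : normedModType R) (f : R -> V) (x : R) df :
  is_derive x 1 f df -> derivable f x 1 /\ derive1 f x = df.
Proof. by case=> d <-; rewrite derive1E. Qed.

Section trigonometry.
Variable R : realType.
Implicit Types (s a : R).

Lemma sin_mulr2 s : sin (2 * s) = 2 * sin s * cos s.
Proof. by rewrite mulr_natl sin_mulr2n mulr2n; ring. Qed.

Lemma cos_mulr2 s : cos (2 * s) = 1 - 2 * sin s ^+ 2.
Proof. by rewrite mulr_natl cos_mulr2n cos2sin2 mulr2n; ring. Qed.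

Lemma sin_lt_id s : 0 < s -> sin s < s.
Proof.
move=> s0; have [s1|s1] := ltP 1 s; first exact: le_lt_trans (sin_le1 s) s1.
have [|c cs] := @MVT R sin cos 0 s s0 (fun x _ => is_derive_sin x).
  by apply: continuous_subspaceT => x; exact: continuous_sin.
move: cs; rewrite in_itv/= => /andP[c0 cs].
(* Strictness: cos c = 1 would make the sine vanish at c, a point of (0, 1) and hence of (0,
   pi/2). *)
rewrite sin0 !subr0 => ->; rewrite gtr_pMl// lt_neqAle cos_le1 andbT.
apply/eqP => cc; have /cos1sin0 sc : `|cos c| = 1 by rewrite cc normr1.
have : 0 < sin c.
  by apply: sin_gt0_pihalf; have := @pihalf_ge1 R; lra.
by rewrite sc ltxx.
Qed.

Lemma sqr_sin_lt s : s != 0 -> sin s ^+ 2 < s ^+ 2.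
Proof.
wlog s0 : s / 0 < s.
  move=> H s_neq0; have [s0|s0|/eqP] := ltgtP s 0; last by rewrite (negbTE s_neq0).
    by rewrite -(sqrrN s) -(sqrrN (sin s)) -sinN H ?oppr_gt0// oppr_eq0.
  exact: H.
move=> _; have [s1|s1] := ltP 1 s.
  by rewrite (@le_lt_trans _ _ 1)// ?expr_gt1// ?ltW// sin2cos2 gerBl sqr_ge0.
have sins : 0 <= sin s.
  by apply: sin_ge0_pi; have := @pi_ge2 R; lra.
by rewrite ltr_pXn2r ?nnegrE// ?ltW// ?sin_lt_id.
Qed.

Lemma sin_addnpi (n : nat) s : sin (s + n%:R * pi) = (- 1) ^+ n * sin s.
Proof. by rewrite mulr_natl alternatingn//; exact: sinDpi. Qed.

Lemma cos_addnpi (n : nat) s : cos (s + n%:R * pi) = (- 1) ^+ n * cos s.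
Proof. by rewrite mulr_natl alternatingn//; exact: cosDpi. Qed.

Lemma sin_natpi (n : nat) : sin (n%:R * pi : R) = 0.
Proof. by have := sin_addnpi n 0; rewrite add0r sin0 mulr0. Qed.

Lemma cos_natpi (n : nat) : cos (n%:R * pi : R) = (- 1) ^+ n.
Proof. by have := cos_addnpi n 0; rewrite add0r cos0 mulr1. Qed.

Lemma sin_intpi (k : int) : sin (k%:~R * pi : R) = 0.
Proof.
by case: (intP k) => [|n|n]; rewrite ?mul0r ?sin0// ?mulrNz ?mulNr ?sinN sin_natpi// oppr0.
Qed.

(** Reduction modulo pi leaves a remainder in [0, pi), where the sine vanishes only at 0. *)
Lemma sin_eq0_ge0 s : 0 <= s -> sin s = 0 -> exists n : nat, s = n%:R * pi.
Proof.
move=> s0; have p0 := @pi_gt0 R.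
have /truncn_itv/andP[] : 0 <= s / pi by rewrite divr_ge0// pi_ge0.
set n := Num.truncn _; rewrite ler_pdivlMr// ltr_pdivrMr// -natr1 => ns sn sins.
exists n; apply/eqP; rewrite eq_sym -subr_eq0 -[_ == 0]negbK; apply/negP => ns0.
have : 0 < sin (s - n%:R * pi).
  apply: sin_gt0_pi; rewrite subr_gt0 lt_neqAle ns andbT.
  by apply/andP; split; [move: ns0; rewrite subr_eq0 | lra].
have := sin_addnpi n (s - n%:R * pi); rewrite subrK sins => /esym/eqP.
by rewrite mulf_eq0 signr_eq0/= => /eqP ->; rewrite ltxx.
Qed.

Lemma sin_eq0 s : sin s = 0 -> exists k : int, s = k%:~R * pi.
Proof.
have [s0|s0] := leP 0 s => sins.
  by have [n ->] := sin_eq0_ge0 s0 sins; exists n.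
have [||n sn] := @sin_eq0_ge0 (- s); first by rewrite oppr_ge0 ltW.
  by rewrite sinN sins oppr0.
by exists (- n%:Z); rewrite mulrNz mulNr -sn opprK.
Qed.

End trigonometry.

(** * The equation u / |x|^2 = mu_tilde(b/2) *)

Section mu_equation.
Variables (R : realType) (a : R).
Hypothesis a0 : 0 < a.
Implicit Types s t : R.

(** Denominators are cleared. The value of [mu_tilde] at 0 gives no solution because a > 0; the
    polynomial equation does hold at s = 0, which the condition on the sine removes. *)
Lemma mu_tilde_eqP s : (mu_dom s /\ a = mu_tilde s) <->
  (sin s != 0 /\ s = a * sin s ^+ 2 + sin s * cos s).
Proof.
split=> [[domS]|[sins eqs]].
  rewrite /mu_tilde; case: eqP => [_ aE|/eqP s0 aE].
    by move: a0; rewrite aE ltxx.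
  have sins : sin s != 0.
    apply/eqP => /sin_eq0[k sE]; apply: (domS k) => //.
    by apply: contraNneq s0 => k0; rewrite sE k0 mul0r.
  split => //; rewrite aE /cot; field.
  exact: sins.
split.
  by move=> k _ sE; move: sins; rewrite sE sin_intpi eqxx.
have s0 : s != 0 by apply: contraNneq sins => ->; rewrite sin0.
rewrite /mu_tilde (negbTE s0) {1}eqs /cot; field.
exact: sins.
Qed.

(** A root with vanishing sine must be 0. Keeping this extra root provides Rolle's theorem with one
    more endpoint. *)
Definition mu_root s := s = a * sin s ^+ 2 + sin s * cos s.

(** For s < 0, sin(-2s) < -2s reads s < sin s cos s, and the term a sin^2 s only increases the
    right-hand side. *)
Lemma mu_root_ge0 s : mu_root s -> 0 <= s.
Proof.
move=> sE; rewrite leNgt; apply/negP => s0.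
have := sin_lt_id (s := - (2 * s)); rewrite sinN sin_mulr2.
have : 0 <= a * sin s ^+ 2 by rewrite mulr_ge0 ?sqr_ge0// ltW.
by move: sE; rewrite /mu_root; lra.
Qed.

Lemma mu_root_le s : mu_root s -> s <= a + 1.
Proof.
move=> ->; apply: lerD.
  by rewrite ler_piMr ?(ltW a0)// sin2cos2 gerBl sqr_ge0.
have := sqr_ge0 (sin s - cos s); have := cos2Dsin2 s.
rewrite sqrrB; lra.
Qed.

(** Dividing the root equation by sin s turns the length quotient into a trigonometric polynomial,
    which can be compared at two roots. *)
Lemma mu_root_sqr s : sin s != 0 -> mu_root s ->
  s ^+ 2 / sin s ^+ 2 = (a * sin s + cos s) ^+ 2.
Proof.
move=> sins sE; rewrite -expr_div_n; congr (_ ^+ 2).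
by rewrite {1}sE; field.
Qed.

(* With [d = t - s], [m = s + t], [P = a sin m + cos m] and
   [Q = a cos m - sin m], the equations give [d = P sin d], and the difference
   of the two sides is [a d + Q sin d], where [P^2 + Q^2 = 1 + a^2] and
   [|sin d| < d] force [|Q sin d| < a d]. *)
Lemma mu_root_lt s t : mu_root s -> mu_root t -> s < t ->
  (a * sin s + cos s) ^+ 2 < (a * sin t + cos t) ^+ 2.
Proof.
move=> sE tE st; pose d := t - s; pose m := s + t.
have d0 : 0 < d by rewrite subr_gt0.
have Cs := cos2sin2 s; have Ct := cos2sin2 t.
have dsq : sin d ^+ 2 < d ^+ 2 by rewrite sqr_sin_lt// gt_eqF.
pose P := a * sin m + cos m; pose Q := a * cos m - sin m.
have sin2B : sin t ^+ 2 - sin s ^+ 2 = sin m * sin d.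
  rewrite /m /d sinD sinB; ring: Cs Ct.
have scB : sin t * cos t - sin s * cos s = cos m * sin d.
  rewrite /m /d cosD sinB; ring: Cs Ct.
have cos2B : cos t ^+ 2 - cos s ^+ 2 = - (sin m * sin d).
  by rewrite -sin2B !cos2sin2; ring.
have dE : d = P * sin d.
  have -> : P * sin d = a * (sin m * sin d) + cos m * sin d by rewrite /P; ring.
  by rewrite -sin2B -scB /d {1}sE {1}tE; ring.
have fE : (a * sin t + cos t) ^+ 2 - (a * sin s + cos s) ^+ 2
    = a * d + Q * sin d.
  have -> : a * d + Q * sin d
    = a ^+ 2 * (sin m * sin d) + 2 * a * (cos m * sin d) - sin m * sin d.
    by rewrite {1}dE /P /Q; ring.
  by rewrite -{2}(opprK (sin m * sin d)) -cos2B -sin2B -scB; ring.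
rewrite -subr_gt0 fE ltNge; apply/negP => le0.
have PQ : P ^+ 2 + Q ^+ 2 = 1 + a ^+ 2.
  by have Cm := cos2sin2 m; rewrite /P /Q; ring: Cm.
have : (a * d) ^+ 2 <= (Q * sin d) ^+ 2.
  have ad0 : 0 <= a * d by rewrite mulr_ge0// ltW.
  by rewrite -(sqrrN (Q * sin d)) ler_pXn2r ?nnegrE//; lra.
have -> : (Q * sin d) ^+ 2 = (1 + a ^+ 2) * sin d ^+ 2 - d ^+ 2.
  by rewrite -PQ [X in _ - X ^+ 2]dE; ring.
have : 0 < (1 + a ^+ 2) * (d ^+ 2 - sin d ^+ 2).
  by rewrite mulr_gt0 ?subr_gt0// ltr_wpDr ?sqr_ge0.
lra.
Qed.

Definition mu_fun s := s - (a * sin s ^+ 2 + sin s * cos s).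

Lemma mu_root_fun s : mu_root s <-> mu_fun s = 0.
Proof.
by rewrite /mu_fun /mu_root; split=> [{1}->|/eqP]; rewrite ?subrr// subr_eq0 => /eqP.
Qed.

Lemma is_derive_mu_fun s :
  is_derive s 1 mu_fun (2 * sin s * (sin s - a * cos s)).
Proof.
rewrite /mu_fun; apply: is_derive_eq; rewrite /GRing.scale/=.
have Cs := cos2sin2 s; ring: Cs.
Qed.

Lemma continuous_mu_fun : continuous mu_fun.
Proof. by move=> s; exact: is_derive_continuous (is_derive_mu_fun s). Qed.

(** The critical points are explicit: zeros of the sine and solutions of tan c = a. They therefore
    count the roots that they separate. *)
Lemma mu_fun_Rolle s t : mu_root s -> mu_root t -> s < t ->
  exists2 c : R, s < c < t & sin c * (sin c - a * cos c) = 0.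
Proof.
move=> /mu_root_fun sE /mu_root_fun tE st.
have [|||c] := @Rolle R mu_fun s t st.
- by move=> c _; case: (is_derive_mu_fun c).
- by apply: continuous_subspaceT; exact: continuous_mu_fun.
- by rewrite sE.
rewrite in_itv/= => cst dc; exists c => //.
have := is_derive_mu_fun c => dc'; have := @derive_val _ _ _ _ _ _ _ dc.
rewrite (@derive_val _ _ _ _ _ _ _ dc') => /eqP.
by rewrite -mulrA mulf_eq0 pnatr_eq0/= => /eqP.
Qed.

Lemma sin_sub_mulcos s : cos s != 0 ->
  (sin s - a * cos s = cos s * (tan s - a)).
Proof. by move=> cs; rewrite /tan; field. Qed.

(** Together with the root 0, two roots would give two distinct critical points in (0, pi/2),
    whereas tan c = a has only one solution there. *)
Lemma mu_root_pihalf_uniq s t : 0 < s < pi / 2 -> 0 < t < pi / 2 ->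
  mu_root s -> mu_root t -> s = t.
Proof.
wlog st : s t / s < t.
  move=> H s0 t0 sE tE; have [st|st|//] := ltgtP s t; first exact: H.
  by apply/esym/H.
move=> /andP[s0 sp] /andP[t0 tp] sE tE.
have root0 : mu_root 0 by rewrite /mu_root sin0 expr0n/= mulr0 mul0r addr0.
have crit c : 0 < c < pi / 2 -> sin c * (sin c - a * cos c) = 0 -> tan c = a.
  move=> c0 /eqP; have sc := sin_gt0_pihalf c0.
  have cc : 0 < cos c by apply: cos_gt0_pihalf; move: c0; have := @pi_gt0 R; lra.
  rewrite mulf_eq0 (gt_eqF sc)/= sin_sub_mulcos ?(gt_eqF cc)//.
  rewrite mulf_eq0 (gt_eqF cc)/=.
  by rewrite subr_eq0 => /eqP.
have [c1 c1s c10] := mu_fun_Rolle root0 sE s0.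
have [c2 c2s c20] := mu_fun_Rolle sE tE st.
have : c1 = c2.
  apply: tan_inj; rewrite ?in_itv/=; try lra.
  by rewrite !crit//; lra.
lra.
Qed.

(** [mu_fun] starts at 0, decreases up to atan a, and equals pi/2 - a > 0 at pi/2; the root lies
    between atan a and pi/2. *)
Lemma mu_root_pihalf_exists : a < pi / 2 ->
  exists2 s : R, 0 < s < pi / 2 & mu_root s.
Proof.
move=> ap; pose th := atan a; have tanth : tan th = a by rewrite /th atanK.
have th0 : 0 < th by rewrite /th -(atan0 R) lt_atan.
have thp : th < pi / 2 by rewrite /th atan_ltpi2.
have fth : mu_fun th < 0.
  have [|c cth] := MVT th0 (fun x _ => is_derive_mu_fun x).
    by apply: continuous_subspaceT; exact: continuous_mu_fun.
  have f0 : mu_fun 0 = 0 by rewrite /mu_fun sin0 expr0n/= mulr0 mul0r addr0 subrr.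
  rewrite f0 !subr0 => ->; rewrite pmulr_llt0//.
  move: cth; rewrite in_itv/= => /andP[c0 cth].
  rewrite -mulrA pmulr_rlt0// pmulr_rlt0; last by apply: sin_gt0_pihalf; lra.
  have cc : 0 < cos c by apply: cos_gt0_pihalf; have := @pi_gt0 R; lra.
  rewrite sin_sub_mulcos ?(gt_eqF cc)// pmulr_rlt0// subr_lt0 -tanth.
  by rewrite ltr_tan// in_itv/=; have := @pi_gt0 R; lra.
have fp : 0 < mu_fun (pi / 2).
  by rewrite /mu_fun sin_pihalf cos_pihalf expr1n mulr1 mulr0 addr0 subr_gt0.
have [||s] := @IVT R mu_fun th (pi / 2) 0 (ltW thp).
- by apply: continuous_subspaceT; exact: continuous_mu_fun.
- by rewrite ge_min le_max (ltW fth) (ltW fp) orbT.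
rewrite in_itv/= => /andP[ths sp] fs; exists s; last by apply/mu_root_fun.
rewrite (lt_le_trans th0 ths)/= lt_neqAle sp andbT.
by apply: contraTneq fp => sp2; rewrite -sp2 fs ltxx.
Qed.

End mu_equation.

(* Each element of [Z] is determined by the number of elements of [C] below
   it. *)
Lemma finite_set_separated (R : realType) (Z C : set R) : finite_set C ->
  (forall s t, Z s -> Z t -> s < t -> exists2 c, s < c < t & C c) ->
  finite_set Z.
Proof.
move=> /finite_seqP[l CE] sep; pose N (z : R) := count (fun c => c < z) l.
have N_lt s t : Z s -> Z t -> s < t -> (N s < N t)%N.
  move=> Zs Zt st; have [c /andP[sc ct] Cc] := sep _ _ Zs Zt st.
  have cl : c \in l by move: Cc; rewrite CE.
  have -> : N t = (N s + count (fun x => (s <= x < t)%R) l)%N.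
    rewrite /N -(count_predUI (fun c => c < s)).
    rewrite (_ : count (predI _ _) l = 0%N) ?addn0.
      apply: eq_count => x /=; apply/idP/idP => [xt|].
        by rewrite xt andbT; case: ltP.
      by case/orP => [xs|/andP[]//]; exact: lt_trans xs st.
    by rewrite -[RHS](count_pred0 l); apply: eq_count => x /=; case: ltP.
  rewrite -addn1 leq_add2l -has_count; apply/hasP; exists c => //.
  by rewrite (ltW sc) ct.
have N_inj : {in Z &, injective N}.
  move=> s t; rewrite !inE => Zs Zt Nst; have [st|st|//] := ltgtP s t.
    by have := N_lt _ _ Zs Zt st; rewrite Nst ltnn.
  by have := N_lt _ _ Zt Zs st; rewrite Nst ltnn.
(* Points outside [Z] are sent out of [I_(size l).+1], so injectivity is only required on [Z]. *)
pose f z := if z \in Z then N z else (size l).+1.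
apply: (@sub_finite_set _ _ (f @^-1` `I_(size l).+1)).
  by move=> z Zz; rewrite /f /= mem_set//= ltnS count_size.
apply: finite_preimage (finite_II _) => s t; rewrite !inE /f /=.
case: ifPn => sZ; last by rewrite ltnn.
case: ifPn => tZ; last by rewrite ltnn.
by move=> _ _; exact: N_inj.
Qed.

Lemma finite_sin_zeros (R : realType) (th B : R) :
  finite_set [set s : R | `|s| <= B /\ sin (s - th) = 0].
Proof.
(* An integer multiple of pi is encoded by its sign and absolute value, which makes the index set a
   product of two finite sets. *)
pose f (e : bool * nat) : R := th + (-1) ^+ e.1 * (e.2%:R * pi).
pose M := (Num.truncn ((B + `|th|) / pi)).+1.
apply: (@sub_finite_set _ _ (f @` (setT `*` `I_M))); last first.
  apply: finite_image; apply: finite_setX; last exact: finite_II.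
  exact: finite_finset.
move=> s [sB /sin_eq0[k sk]].
have p0 := @pi_gt0 R.
have kM : (`|k| < M)%N.
  rewrite -(ltr_nat R) /M.
  apply: le_lt_trans (truncnS_gt ((B + `|th|) / pi)).
  rewrite ler_pdivlMr// natr_absz.
  have -> : `|k|%:~R * pi = `|s - th|.
    by rewrite sk normrM (gtr0_norm p0) intr_norm.
  by rewrite (le_trans (ler_normB _ _))// lerD2r.
exists ((k < 0), `|k|%N) => //=.
rewrite /f /= -[s](subrK th) sk addrC; congr (_ + _).
rewrite mulrA; congr (_ * _).
by rewrite [in RHS](intEsign k) intrM rmorphXn.
Qed.

(** Up to the nonzero factor cos(atan a), sin c - a cos c is sin(c - atan a). All critical points
    separating roots are thus zeros of shifted sines, bounded by a + 1. *)
Lemma finite_mu_root (R : realType) (a : R) : 0 < a -> finite_set (mu_root a).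
Proof.
move=> a0.
pose C th := [set s : R | `|s| <= a + 1 /\ sin (s - th) = 0].
apply: (@finite_set_separated _ _ (C 0 `|` C (atan a))).
  by rewrite finite_setU; split; exact: finite_sin_zeros.
move=> s t sE tE st; have [c /andP[sc ct] /eqP c0] := mu_fun_Rolle sE tE st.
exists c; first by rewrite sc ct.
have cB : `|c| <= a + 1.
  have := mu_root_ge0 a0 sE; have := mu_root_le a0 tE => tB s0.
  by rewrite ger0_norm; lra.
move: c0; rewrite mulf_eq0 => /orP[|] /eqP c0; [left | right]; split => //.
  by rewrite subr0.
have cth : cos (atan a) != 0.
  by rewrite gt_eqF// cos_gt0_pihalf// atan_gtNpi2 atan_ltpi2.
have -> : sin (c - atan a) = cos (atan a) * (sin c - tan (atan a) * cos c).
  by rewrite sinB /tan; field.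
by rewrite atanK c0 mulr0.
Qed.

(** * Vector-valued derivatives and the horizontal norm *)

Section is_derive_vector.
Variables (R : realType).
Implicit Types V W : normedModType R.

Lemma is_derive_cvgP V (f : R -> V) (x : R) (df : V) :
  is_derive x 1 f df <-> h^-1 *: (f (h + x) - f x) @[h --> 0^'] --> df.
Proof.
have E : (fun h : R => h^-1 *: (f (h *: 1 + x) - f x))
    = (fun h : R => h^-1 *: (f (h + x) - f x)).
  by apply/funext => h; rewrite [_%:A]mulr1.
split=> [[dfx <-]|fdf].
  by move: dfx; rewrite /derivable /derive E.
split; first by rewrite /derivable E; apply: cvgP fdf.
by rewrite /derive E; apply: cvg_lim fdf; exact: norm_hausdorff.
Qed.

(** Projections, coordinates and multiplication of a fixed vector by a scalar function are all
    instances. *)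
Lemma is_derive_linear_comp V W (L : V -> W) (f : R -> V) (x : R) (df : V) :
  linear L -> continuous L -> is_derive x 1 f df ->
  is_derive x 1 (fun t => L (f t)) (L df).
Proof.
move=> linL contL /is_derive_cvgP fdf; apply/is_derive_cvgP.
have LZ k v : L (k *: v) = k *: L v.
  have L0 : L 0 = 0.
    have := linL 1 0 0; rewrite !scale1r addr0 => /esym/eqP.
    by rewrite -subr_eq0 addrK => /eqP.
  by have := linL k v 0; rewrite !addr0 L0 addr0.
have LB u v : L (u - v) = L u - L v.
  by have := linL (-1) v u; rewrite !scaleN1r (addrC _ u) (addrC _ (L u)).
have -> : (fun h : R => h^-1 *: (L (f (h + x)) - L (f x)))
    = (fun h : R => L (h^-1 *: (f (h + x) - f x))).
  by apply/funext => h; rewrite LZ LB.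
exact: (continuous_cvg _ (contL df) fdf).
Qed.

Lemma is_derive_scalel V (v : V) (f : R -> R) (x df : R) :
  is_derive x 1 f df -> is_derive x 1 (fun t => f t *: v) (df *: v).
Proof.
apply: (@is_derive_linear_comp R^o V ( *:%R^~ v)).
- by move=> k a b /=; rewrite scalerDl scalerA.
- exact: scalel_continuous.
Qed.

Lemma is_derive_fst V W (f : R -> V * W) (x : R) (df : V * W) :
  is_derive x 1 f df -> is_derive x 1 (fun t => (f t).1) df.1.
Proof.
by apply: (is_derive_linear_comp (L := fst)) => // -[u v]; exact: cvg_fst.
Qed.

Lemma is_derive_snd V W (f : R -> V * W) (x : R) (df : V * W) :
  is_derive x 1 f df -> is_derive x 1 (fun t => (f t).2) df.2.
Proof.
by apply: (is_derive_linear_comp (L := snd)) => // -[u v]; exact: cvg_snd.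
Qed.

Lemma is_derive_pair V W (f : R -> V) (g : R -> W) (x : R) (df : V) (dg : W) :
  is_derive x 1 f df -> is_derive x 1 g dg ->
  is_derive x 1 (fun t => (f t, g t)) (df, dg).
Proof.
move=> /is_derive_cvgP fdf /is_derive_cvgP gdg; apply/is_derive_cvgP.
exact: (cvg_pair fdf gdg).
Qed.

Lemma is_derive_coord n (f : R -> 'rV[R]_n) (x : R) (df : 'rV[R]_n) (j : 'I_n) :
  is_derive x 1 f df -> is_derive x 1 (fun t => f t 0 j : R) (df 0 j : R).
Proof.
apply: (@is_derive_linear_comp _ R^o (fun v : 'rV[R]_n => v 0 j)).
  by move=> k u v; rewrite !mxE.
exact: coord_continuous.
Qed.

Lemma is_derive_addv V (f g : R -> V) (x : R) (df dg : V) :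
  is_derive x 1 f df -> is_derive x 1 g dg ->
  is_derive x 1 (fun t => f t + g t) (df + dg).
Proof. exact: is_deriveD. Qed.

End is_derive_vector.

Section hcomb.
Variables (R : realType) (n : nat).
Implicit Types (p v : space R n) (a b : 'rV[R]_n).

Lemma sum_pair (I : finType) (F : I -> 'rV[R]_n) (G : I -> R) :
  \sum_(i : I) ((F i, G i) : space R n) = (\sum_i F i, \sum_i G i).
Proof.
by elim/big_rec3: _ => // i x y z _ ->.
Qed.

Lemma hcombE p a b : hcomb p a b = (a, dot b p.1).
Proof.
rewrite /hcomb (eq_bigr (fun j => (a 0 j *: delta_mx 0 j, b 0 j * p.1 0 j))).
  by rewrite sum_pair -row_sum_delta.
move=> j _; rewrite /vfX /vfU; congr pair => /=.
  by rewrite scaler0 addr0.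
by rewrite scaler0 add0r.
Qed.

(* Minimising |beta|^2 under u' = beta . x gives beta = (u' / |x|^2) x, whence
   |beta|^2 = u'^2 / |x|^2; at x = 0 this is 0, which agrees with 0^-1 = 0. *)
Lemma cc_sqnorm_hcomb p a b :
  cc_sqnorm p (a, dot b p.1)
    = (dot a a + dot b p.1 ^+ 2 / dot p.1 p.1)%:E.
Proof.
set x := p.1; have sumE (y z : 'rV[R]_n) :
    \sum_(j < n) (y 0 j ^+ 2 + z 0 j ^+ 2) = dot y y + dot z z.
  by rewrite big_split.
pose k := dot b x / dot x x.
have kx : dot (k *: x) x = dot b x.
  rewrite dotZl /k; have [x0|x0] := eqVneq x 0.
    by rewrite x0 dotC dot0l mul0r mul0r.
  by rewrite divfK// dot_eq0.
have kxx : dot (k *: x) (k *: x) = dot b x ^+ 2 / dot x x.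
  by rewrite dotZr kx /k; ring.
apply/eqP; rewrite eq_le; apply/andP; split.
  apply: ereal_inf_lbound; exists (a, k *: x); first by rewrite /= hcombE kx.
  by rewrite sumE /= kxx.
apply: le_ereal_inf_tmp => _ [[a' b'] /= ab <-].
move: ab; rewrite hcombE => -[<- bx]; rewrite sumE lee_fin lerD2l.
have [x0|x0] := eqVneq x 0.
  by rewrite x0 dot0l invr0 mulr0 dot_ge0.
rewrite -subr_ge0.
(* Both b' and k x have the same product with x, so the excess over the minimum is |b' - k x|^2. *)
have <- : dot (b' - k *: x) (b' - k *: x) = dot b' b' - dot b x ^+ 2 / dot x x.
  rewrite dotDl !dotDr !dotNl !dotNr kxx (dotZr k b') (dotZl k x b') (dotC x b').
  by rewrite -[dot b' x]bx /k /x; ring.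
exact: dot_ge0.
Qed.

Lemma cc_norm_hcomb p a b : cc_norm p (a, dot b p.1)
    = (Num.sqrt (dot a a + dot b p.1 ^+ 2 / dot p.1 p.1))%:E.
Proof. by rewrite /cc_norm cc_sqnorm_hcomb. Qed.

End hcomb.

(** * Absolutely continuous functions on [0, 1] *)

Lemma abs_continuous01_dominated (R : realType) (V W : normedModType R)
    (g : R -> V) (h : R -> W) (K : R) :
  (forall s t : R, 0 <= s -> s <= t -> t <= 1 -> `|h t - h s| <= K * `|g t - g s|) ->
  abs_continuous01 g -> abs_continuous01 h.
Proof.
move=> hgK acg e e0; pose K' := `|K| + 1.
have K'0 : 0 < K' by rewrite ltr_wpDl.
have [d d0 gd] := acg (e / K') (divr_gt0 e0 K'0).
exists d => // m s t st dis sd.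
apply: (@le_lt_trans _ _ (\sum_(i < m) K' * `|g (t i) - g (s i)|)).
  apply: ler_sum => i _; have [s0 st0 t1] := st i.
  apply: le_trans (hgK _ _ s0 st0 t1) _; rewrite ler_wpM2r//.
  by rewrite /K' (le_trans (ler_norm K))// lerDl.
by rewrite -mulr_sumr mulrC -ltr_pdivlMr//; exact: gd.
Qed.

Section abs_continuous_real.
Variable R : realType.
Implicit Types f g h : R -> R.

Lemma abs_continuous01_id : abs_continuous01 (fun t : R => t).
Proof.
move=> e e0; exists e => // m s t st _ sd.
rewrite (eq_bigr (fun i => t i - s i))// => i _.
by have [_ ? _] := st i; rewrite ger0_norm// subr_ge0.
Qed.

Lemma abs_continuous01_lipschitz (V : normedModType R) (h : R -> V) (K : R) :
  (forall s t : R, 0 <= s -> s <= t -> t <= 1 -> `|h t - h s| <= K * (t - s)) ->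
  abs_continuous01 h.
Proof.
move=> hK; apply: abs_continuous01_dominated abs_continuous01_id => s t s0 st t1.
by rewrite [`|t - s|]ger0_norm ?subr_ge0//; exact: hK.
Qed.

Lemma abs_continuous01_add f g : abs_continuous01 f -> abs_continuous01 g ->
  abs_continuous01 (fun t => f t + g t).
Proof.
move=> acf acg e e0; have e20 : 0 < e / 2 by rewrite divr_gt0.
have [d d0 fd] := acf _ e20; have [d' d'0 gd] := acg _ e20.
exists (Num.min d d'); first by rewrite lt_min d0.
move=> m s t st dis; rewrite lt_min => /andP[sd sd'].
apply: (@le_lt_trans _ _ (\sum_(i < m) (`|f (t i) - f (s i)| + `|g (t i) - g (s i)|))).
  by apply: ler_sum => i _; rewrite opprD addrACA ler_normD.
have := fd m s t st dis sd; have := gd m s t st dis sd'.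
by rewrite big_split/=; lra.
Qed.

(** [0, 1] is cut into N + 1 steps shorter than the d belonging to e = 1; over each of them f
    changes by less than 1. *)
Lemma abs_continuous01_bounded f : abs_continuous01 f ->
  exists K, forall t, 0 <= t <= 1 -> `|f t| <= K.
Proof.
move=> acf; have [d d0 fd] := acf 1 ltr01.
have fd' s t : 0 <= s -> s <= t -> t <= 1 -> t - s < d -> `|f t - f s| < 1.
  move=> s0 st t1 tsd; have := fd 1%N (fun=> s) (fun=> t).
  rewrite !big_ord_recl !big_ord0 !addr0; apply => //.
  by move=> i j _ _ _; rewrite !ord1.
have [N Nd] : exists N : nat, d^-1 < N.+1%:R.
  by exists (Num.truncn d^-1); exact: truncnS_gt.
have N0 : 0 < N.+1%:R :> R by [].
exists (`|f 0| + N.+1%:R + 1) => t /andP[t0 t1].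
have fk (k : nat) : (k <= N.+1)%N -> `|f (k%:R / N.+1%:R)| <= `|f 0| + k%:R.
  elim: k => [_|k ih kN]; first by rewrite mul0r addr0.
  have kN1 : k.+1%:R / N.+1%:R <= 1 :> R by rewrite ler_pdivrMr// mul1r ler_nat.
  have step : k.+1%:R / N.+1%:R - k%:R / N.+1%:R < d :> R.
    rewrite -mulrBl -natrB// subSnn mul1r.
    by rewrite -[ltRHS]invrK ltf_pV2 ?posrE ?invr_gt0.
  have := fd' (k%:R / N.+1%:R) (k.+1%:R / N.+1%:R) _ _ kN1 step.
  rewrite divr_ge0// ler_pM2r ?invr_gt0// ler_nat leqnSn => /(_ erefl erefl).
  have := ih (ltnW kN); have := ler_dist_dist (f (k.+1%:R / N.+1%:R)) (f (k%:R / N.+1%:R)).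
  have := ler_norm (`|f (k.+1%:R / N.+1%:R)| - `|f (k%:R / N.+1%:R)|).
  by rewrite -natr1; lra.
pose k := Num.truncn (t * N.+1%:R).
have /truncn_itv/andP[kt tk] : 0 <= t * N.+1%:R by rewrite mulr_ge0.
have kN : (k <= N.+1)%N.
  by rewrite -(ler_nat R) (le_trans kt)// ler_piMl// ler0n.
have kt' : k%:R / N.+1%:R <= t by rewrite ler_pdivrMr.
have step : t - k%:R / N.+1%:R < d.
  rewrite (@lt_trans _ _ N.+1%:R^-1)//; last first.
    by rewrite -[ltRHS]invrK ltf_pV2 ?posrE ?invr_gt0.
  by rewrite ltrBlDr -[X in X + _]mul1r -mulrDl nat1r ltr_pdivlMr.
have := fd' _ _ (divr_ge0 (ler0n _ _) (ltW N0)) kt' t1 step.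
have := fk _ kN; have := ler_dist_dist (f t) (f (k%:R / N.+1%:R)).
have := ler_norm (`|f t| - `|f (k%:R / N.+1%:R)|).
have : k%:R <= N.+1%:R :> R by rewrite ler_nat.
lra.
Qed.

Lemma abs_continuous01_mul f g : abs_continuous01 f -> abs_continuous01 g ->
  abs_continuous01 (fun t => f t * g t).
Proof.
move=> acf acg; have [K fK] := abs_continuous01_bounded acf.
have [L gL] := abs_continuous01_bounded acg.
move=> e e0; pose M := `|K| + `|L| + 1.
have M0 : 0 < M by rewrite ltr_wpDl// addr_ge0.
have e20 : 0 < e / 2 / M by rewrite !divr_gt0.
have [d d0 fd] := acf _ e20; have [d' d'0 gd] := acg _ e20.
exists (Num.min d d'); first by rewrite lt_min d0.
move=> m s t st dis; rewrite lt_min => /andP[sd sd'].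
apply: (@le_lt_trans _ _ (\sum_(i < m) M * (`|f (t i) - f (s i)| + `|g (t i) - g (s i)|))).
  apply: ler_sum => i _; have [s0 st0 t1] := st i.
  have -> : f (t i) * g (t i) - f (s i) * g (s i)
      = g (t i) * (f (t i) - f (s i)) + f (s i) * (g (t i) - g (s i)) by ring.
  rewrite (le_trans (ler_normD _ _))// !normrM mulrDr; apply: lerD.
    apply: ler_wpM2r => //; rewrite (le_trans (gL _ _))//; first by rewrite (le_trans s0).
    by have := ler_norm L; have := normr_ge0 K; rewrite /M; lra.
  apply: ler_wpM2r => //; rewrite (le_trans (fK _ _))//; first by rewrite s0 (le_trans st0).
  by have := ler_norm K; have := normr_ge0 L; rewrite /M; lra.
rewrite -mulr_sumr mulrC -ltr_pdivlMr// big_split/=.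
have := fd m s t st dis sd; have := gd m s t st dis sd'.
rewrite -(mulrA e) (mulrC 2^-1) mulrA; lra.
Qed.

Lemma abs_continuous01_cst (c : R) : abs_continuous01 (fun _ : R => c).
Proof.
apply: (@abs_continuous01_lipschitz R (fun=> c) 0) => s t _ _ _.
by rewrite subrr normr0 mul0r.
Qed.

Lemma abs_continuous01_sum n (F : 'I_n -> R -> R) :
  (forall j, abs_continuous01 (F j)) ->
  abs_continuous01 (fun t => \sum_(j < n) F j t).
Proof.
elim: n F => [|n ih] F acF.
  have -> : (fun t => \sum_(j < 0) F j t) = fun=> 0.
    by apply/funext => t; rewrite big_ord0.
  exact: abs_continuous01_cst.
have -> : (fun t => \sum_(j < n.+1) F j t)
    = (fun t => F ord0 t + \sum_(j < n) F (lift ord0 j) t).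
  by apply/funext => t; rewrite big_ord_recl.
apply: (abs_continuous01_add (acF ord0)).
exact: (ih (fun j => F (lift ord0 j))).
Qed.

Lemma lipschitz_C1 (f df : R -> R) :
  (forall t : R, 0 <= t <= 1 -> is_derive t 1 f (df t)) ->
  {within `[0, 1], continuous df} ->
  exists K, forall s t : R, 0 <= s -> s <= t -> t <= 1 ->
    `|f t - f s| <= K * (t - s).
Proof.
move=> fdf cdf.
have cndf : {within `[0, 1], continuous (fun t => `|df t|)}.
  move=> t; apply: (continuous_comp (cdf t)); exact: norm_continuous.
have [c _ cmax] := EVT_max ler01 cndf.
exists `|df c| => s t s0 st t1; have [->|st'] := eqVneq s t.
  by rewrite !subrr normr0 mulr0.
have {st st'}st : s < t by rewrite lt_neqAle st'.
have [||x] := @MVT R f df s t st.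
- move=> x; rewrite in_itv/= => /andP[sx xt]; apply: fdf; lra.
- apply: derivable_within_continuous => x; rewrite in_itv/= => /andP[sx xt].
  by have [] : is_derive x 1 f (df x) by apply: fdf; lra.
rewrite in_itv/= => /andP[sx xt] ->; rewrite normrM [`|t - s|]gtr0_norm ?subr_gt0//.
by rewrite ler_pM2r ?subr_gt0//; apply: cmax; rewrite in_itv/=; lra.
Qed.

(** Composition does not preserve absolute continuity in general; here the outer function is C^1,
    hence Lipschitz. *)
Lemma abs_continuous01_comp (f df g : R -> R) :
  (forall t : R, 0 <= t <= 1 -> is_derive t 1 f (df t)) ->
  {within `[0, 1], continuous df} ->
  (forall s t : R, 0 <= s -> s <= t -> t <= 1 ->
    [/\ 0 <= g s, g s <= g t & g t <= 1]) ->
  abs_continuous01 g -> abs_continuous01 (fun t => f (g t)).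
Proof.
move=> fdf cdf g01 acg; have [K fK] := lipschitz_C1 fdf cdf.
apply: (@abs_continuous01_dominated _ _ _ _ _ K) acg => s t s0 st t1.
have [gs0 gst gt1] := g01 _ _ s0 st t1.
by rewrite [`|g t - g s|]ger0_norm ?subr_ge0//; exact: fK.
Qed.

End abs_continuous_real.

(** * Monotonicity from the sign of the derivative almost everywhere *)

Lemma real_induction (R : realType) (P : R -> Prop) :
  P 0 ->
  (forall s : R, 0 <= s <= 1 -> exists2 r : R, 0 < r & forall t t' : R,
     0 <= t -> t' <= 1 -> s - r < t <= s -> s <= t' < s + r -> P t -> P t') ->
  P 1.
Proof.
move=> P0 step; pose A := [set t : R | 0 <= t <= 1 /\ P t].
have A0 : A 0 by split=> //; rewrite lexx ler01.
have supA : has_sup A.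
  by split; [exists 0 | exists 1 => t [/andP[]]].
have s0 : 0 <= sup A by apply: (sup_upper_bound supA).
have s1 : sup A <= 1 by apply: ge_sup; [exists 0 | move=> t [/andP[]]].
have [|r r0 stepr] := step (sup A); first by rewrite s0.
have [t At rt] := sup_adherent r0 supA.
have ts : t <= sup A by apply: (sup_upper_bound supA).
have [[/andP[t0 t1] Pt]] := At.
(* The step bridges the supremum, from t just below it to t' above it; t' cannot exceed the
   supremum, so the minimum must be 1. *)
pose t' := Num.min 1 (sup A + r / 2).
have t'1 : t' <= 1 by rewrite ge_min lexx.
have st' : sup A <= t' by rewrite le_min s1/=; lra.
have Pt' : P t'.
  apply: (stepr t) => //; first by rewrite rt ts.
  by rewrite st' gt_min; apply/orP; right; lra.
have : t' <= sup A.
  by apply: (sup_upper_bound supA); split => //; rewrite t'1 (le_trans s0 st').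
rewrite ge_min => /orP[s1'|]; last by lra.
suff <- : t' = 1 by [].
apply/eqP; rewrite eq_le t'1/=; exact: le_trans st'.
Qed.

(** Both sides of t are covered because real induction steps from a point below t to a point above
    it. *)
Lemma derivable_nonpos_increment (R : realType) (h : R -> R) (t e : R) :
  derivable h t 1 -> derive1 h t <= 0 -> 0 < e ->
  exists2 r : R, 0 < r & forall s : R, `|s - t| < r ->
    (t <= s -> h s - h t <= e * (s - t)) /\
    (s <= t -> h t - h s <= e * (t - s)).
Proof.
move=> dh h0 e0.
have /cvgrPdist_lt /(_ e e0) : (k^-1 *: (h (k + t) - h t)) @[k --> 0^'] --> derive1 h t.
  rewrite derive1E; move: dh; rewrite /derivable /derive.
  by under eq_fun do rewrite [_%:A]mulr1.
rewrite near_withinE => /nbhs_ballP[r /= r0 hr]; exists r => // s str.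
have [->|st] := eqVneq s t; first by rewrite !subrr mulr0.
have /= := hr (s - t).
rewrite /ball /= sub0r normrN => /(_ str); rewrite subr_eq0 => /(_ st).
rewrite subrK ltr_norml => /andP[h1 _].
have {}h1 : (s - t)^-1 * (h s - h t) < e by move: h1; rewrite /GRing.scale/=; lra.
split=> [ts|ts].
- have st0 : 0 < s - t by rewrite subr_gt0 lt_neqAle eq_sym st.
  by move: h1; rewrite mulrC ltr_pdivrMr// => /ltW.
- have st0 : s - t < 0 by rewrite subr_lt0 lt_neqAle st.
  move: h1; rewrite mulrC ltr_ndivrMr//; lra.
Qed.

(* Cover the exceptional null set by an open set U of small measure and move from
   0 to 1 by real induction: outside U the increments are controlled by the
   derivative, inside U by absolute continuity. *)
Lemma ac_nonincreasing (R : realType) (h : R -> R) (N : set R) :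
  abs_continuous01 h -> (@lebesgue_measure R).-negligible N ->
  (forall t : R, 0 < t < 1 -> ~ N t -> derivable h t 1 /\ derive1 h t <= 0) ->
  h 1 <= h 0.
Proof.
move=> ach Nnegl hN.
apply/ler_addgt0Pr => e0 e00.
pose e := e0 / 2; have e_gt0 : 0 < e by rewrite /e; lra.
have -> : e0 = e + e by rewrite /e; lra.
have [d d0 hd] := ach e e_gt0.
(* The endpoints are put into U because the derivative is controlled only in the open interval. *)
have [U [oU NU Ud]] : exists U : set R,
    [/\ open U, N `|` [set 0; 1] `<=` U & (lebesgue_measure U < d%:E)%E].
  have [A [mA A0 NA]] : (@lebesgue_measure R).-negligible (N `|` [set 0; 1]).
    apply: negligibleU => //; apply: negligibleU.
    - by exists [set 0]; split => //; exact: lebesgue_measure_set1.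
    - by exists [set 1]; split => //; exact: lebesgue_measure_set1.
  have [|U [oU AU UA]] := @lebesgue_regularity_outer R A d mA _ d0.
    by move: A0 => /= ->; rewrite ltry.
  exists U; split => //; first exact: subset_trans AU.
  have mU : measurable U by exact: open_measurable.
  rewrite -(setDUK AU) measureU//; last 2 first.
    - exact: measurableD.
    - by rewrite setDE setIC -setIA (setIC _ A) setICr setI0.
  by move: A0 => /= ->; rewrite add0e.
(* The disjoint intervals record the excursions inside U made up to t. Their total length stays
   below |U| < d, so at t = 1 their increments sum to less than e. *)
pose P (t : R) := exists (m : nat) (a b : nat -> R),
  [/\ forall i, (i < m)%N -> [/\ 0 <= a i, a i <= b i & b i <= t],
      trivIset setT (fun i : 'I_m => `]a i, b i[%classic),
      forall i, (i < m)%N -> `]a i, b i[ `<=` U &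
      h t - h 0 <= e * t + \sum_(i < m) `|h (b i) - h (a i)|].
suff [m [a [b [ab tab abU hab]]]] : P 1.
  suff : \sum_(i < m) `|h (b i) - h (a i)| < e by lra.
  apply: (hd m (a \o val) (b \o val)) => //.
    by move=> i; case: (ab i (ltn_ord i)).
  rewrite -lte_fin (le_lt_trans _ Ud)//.
  have -> : (\sum_(i < m) (b i - a i))%:E
      = lebesgue_measure (\big[setU/set0]_(i < m) `]a i, b i[%classic).
    rewrite measure_bigsetU_ord//= -sumEFin; apply: eq_bigr => i _.
    case: (ab i (ltn_ord i)) => _ aibi _.
    rewrite lebesgue_measure_itv/= lte_fin; case: ltP => // biai.
    by have -> : b i = a i; [lra | rewrite subrr].
  apply: le_measure; rewrite ?inE.
  - exact: bigsetU_measurable.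
  - exact: open_measurable.
  - by rewrite -(bigcup_mkord _ (fun i => `]a i, b i[%classic)) => t [i /= im];
      exact: abU.
apply: real_induction.
  exists 0%N, (fun=> 0), (fun=> 0); split => //.
    by move=> i; case: i.
  by rewrite big_ord0 subrr mulr0 addr0.
move=> s s01; have [Us|nUs] := pselect (U s).
(* For s in U the interval from t to t' lies in U and is appended to the list. *)
- have /nbhs_ballP[r /= r0 rU] : nbhs s U by apply: open_nbhs_nbhs.
  exists r => // t t' t0 t'1 /andP[srt ts] /andP[st' t'sr].
  move=> [m [a [b [ab tab abU hab]]]].
  exists m.+1, (fun i => if (i < m)%N then a i else t),
    (fun i => if (i < m)%N then b i else t').
  have tt' := le_trans ts st'.
  have ittU : `]t, t'[ `<=` U.
    move=> x /=; rewrite in_itv/= => /andP[tx xt']; apply: rU.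
    by rewrite /ball/= ltr_norml; lra.
  split.
  + move=> i im1; case: ltnP => im; last by split.
    by case: (ab i im) => ? ? ?; split => //; exact: le_trans tt'.
  + move=> i j _ _ [x [/= xi xj]].
    move: xi xj; have [im|im] := ltnP i m; have [jm|jm] := ltnP j m => xi xj.
    * apply: val_inj => /=.
      have : Ordinal im = Ordinal jm by apply: tab => //; exists x.
      by move/(congr1 val).
    * case: (ab i im) => _ _ bt; move: xi xj; rewrite !in_itv/=.
      move=> /andP[_ xb] /andP[tx _].
      by have := lt_trans tx (lt_le_trans xb bt); rewrite ltxx.
    * case: (ab j jm) => _ _ bt; move: xi xj; rewrite !in_itv/=.
      move=> /andP[tx _] /andP[_ xb].
      by have := lt_trans tx (lt_le_trans xb bt); rewrite ltxx.
    * apply: val_inj => /=; move: (ltn_ord i) (ltn_ord j); rewrite !ltnS.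
      by move=> i1 j1; apply/eqP; rewrite eqn_leq (leq_trans i1 jm) (leq_trans j1 im).
  + by move=> i im1; case: ltnP => im //; exact: abU.
  + rewrite big_ord_recr/= ltnn.
    under eq_bigr do rewrite ltn_ord.
    have := ler_norm (h t' - h t).
    have : e * t <= e * t' by rewrite ler_pM2l.
    lra.
(* For s outside U the list is kept and the derivative bounds the increment by e (t' - t). *)
- have s01' : 0 < s < 1.
    have s0 : s != 0 by apply/eqP => s0; apply: nUs; apply: NU; right; left.
    have s1 : s != 1 by apply/eqP => s1; apply: nUs; apply: NU; right; right.
    move: s01; rewrite !lt_neqAle eq_sym s0 s1/=; lra.
  have [|dh h0] := hN s s01'; first by move=> Ns; apply: nUs; apply: NU; left.
  have [r r0 hr] := derivable_nonpos_increment dh h0 e_gt0.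
  exists r => // t t' t0 t'1 /andP[srt ts] /andP[st' t'sr].
  move=> [m [a [b [ab tab abU hab]]]]; exists m, a, b; split => //.
    by move=> i im; case: (ab i im) => ? ? bt; split => //; exact: le_trans bt (le_trans ts st').
  have [|_ /(_ ts)] := hr t; first by rewrite ltr_norml; lra.
  have [|/(_ st') + _] := hr t'; first by rewrite ltr_norml; lra.
  rewrite !mulrBr; lra.
Qed.

(** * The curves gamma^{b,c} *)

Section gamma.
Variables (R : realType) (n : nat) (x : 'rV[R]_n) (b : R) (c : 'rV[R]_n).
Hypothesis b0 : b != 0.

Definition gamma1 (t : R) : 'rV[R]_n := (sin (b * t) / b) *: c + cos (b * t) *: x.

Definition gamma1' (t : R) : 'rV[R]_n :=
  cos (b * t) *: c + (- (b * sin (b * t))) *: x.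

Lemma gamma_fst (t : R) : (gamma x b c t).1 = gamma1 t.
Proof. by rewrite /gamma (negbTE b0). Qed.

Lemma is_derive_gamma1 (t : R) : is_derive t 1 gamma1 (gamma1' t).
Proof.
apply: is_derive_addv; apply: is_derive_scalel.
  apply: is_derive_eq; rewrite /GRing.scale/=; field.
  exact: b0.
by apply: is_derive_eq; rewrite /GRing.scale/=; ring.
Qed.

Lemma is_derive_gamma1' (t : R) : is_derive t 1 gamma1' (- (b ^+ 2 *: gamma1 t)).
Proof.
have -> : - (b ^+ 2 *: gamma1 t)
    = (- (b * sin (b * t))) *: c + (- (b ^+ 2 * cos (b * t))) *: x.
  apply/rowP => j; rewrite /gamma1 !mxE; field.
  exact: b0.
apply: is_derive_addv; apply: is_derive_scalel;
  by apply: is_derive_eq; rewrite /GRing.scale/=; ring.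
Qed.

Lemma dot_gamma1 (t : R) : dot (gamma1 t) (gamma1 t)
  = (sin (b * t) / b) ^+ 2 * dot c c
    + 2 * (sin (b * t) / b) * cos (b * t) * dot x c
    + cos (b * t) ^+ 2 * dot x x.
Proof.
by rewrite /gamma1 dotDl !dotDr !dotZl !dotZr (dotC c x); ring.
Qed.

(** The second component is b |y|^2 with y = [gamma1 t]: the control beta is b y, so b is the
    multiplier lambda of the Euler-Lagrange equations. *)
Lemma is_derive_gamma (t : R) :
  is_derive t 1 (gamma x b c) (gamma1' t, b * dot (gamma1 t) (gamma1 t)).
Proof.
rewrite /gamma (negbTE b0); apply: is_derive_pair; first exact: is_derive_gamma1.
apply: is_derive_eq; rewrite /GRing.scale/=.
rewrite dot_gamma1 -!enorm_sqr.
have Cs := cos2sin2 (b * t).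
have -> : cos (2 * b * t) = 1 - 2 * sin (b * t) ^+ 2.
  by rewrite -mulrA cos_mulr2.
by field: Cs; exact: b0.
Qed.

Lemma derive1_gamma (t : R) :
  derive1 (gamma x b c) t = (gamma1' t, dot (b *: gamma1 t) (gamma x b c t).1).
Proof. by rewrite (derive1_val (is_derive_gamma t)).2 gamma_fst dotZl. Qed.

Lemma continuous_gamma : continuous (gamma x b c).
Proof.
move=> t; have [d _] := is_derive_gamma t.
by apply: differentiable_continuous; apply/derivable1_diffP.
Qed.

Lemma gamma_geodesic : geodesic (gamma x b c).
Proof.
split; first exact: continuous_subspaceT continuous_gamma.
exists b, (fun t => b *: gamma1 t) => t _.
have d2E : (fun s => (derive1 (gamma x b c) s).1) = gamma1'.
  by apply/funext => s; rewrite derive1_gamma.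
rewrite d2E derive1_gamma gamma_fst; split => //.
- by have [] := derive1_val (is_derive_gamma t).
- by have [] := derive1_val (is_derive_gamma1' t).
- by rewrite (derive1_val (is_derive_gamma1' t)).2 scalerA.
Qed.

(** The squared speed is |y'|^2 + b^2 |y|^2, the conserved energy of the oscillator. *)
Lemma gamma_speed (t : R) : cc_norm (gamma x b c t) (derive1 (gamma x b c) t)
  = (Num.sqrt (enorm c ^+ 2 + b ^+ 2 * enorm x ^+ 2))%:E.
Proof.
rewrite derive1_gamma cc_norm_hcomb gamma_fst dotZl; congr (Num.sqrt _)%:E.
(* This also holds where the curve crosses y = 0, since 0 / 0 is 0. *)
have -> : (b * dot (gamma1 t) (gamma1 t)) ^+ 2 / dot (gamma1 t) (gamma1 t)
    = b ^+ 2 * dot (gamma1 t) (gamma1 t).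
  have [->|d0] := eqVneq (dot (gamma1 t) (gamma1 t)) 0; first by ring.
  by field.
rewrite dot_gamma1 /gamma1' dotDl !dotDr !dotZl !dotZr (dotC c x) !enorm_sqr.
have Cs := cos2sin2 (b * t); by field: Cs; exact: b0.
Qed.

Lemma cc_length_gamma : cc_length (gamma x b c)
  = (Num.sqrt (enorm c ^+ 2 + b ^+ 2 * enorm x ^+ 2))%:E.
Proof.
rewrite /cc_length.
under eq_integral do rewrite gamma_speed.
rewrite integral_cst//= lebesgue_measure_itv/= lte01.
by rewrite sube0 mule1.
Qed.

Lemma gamma_horizontal : horizontal (gamma x b c).
Proof.
split; last first.
  apply: aeW => t _; split; first by have [] := derive1_val (is_derive_gamma t).
  by exists (gamma1' t), (b *: gamma1 t); rewrite hcombE derive1_gamma.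
have [K1 hK1] : exists K, forall s t : R, 0 <= s -> s <= t -> t <= 1 ->
    `|sin (b * t) / b - sin (b * s) / b| <= K * (t - s).
  apply: (@lipschitz_C1 _ (fun t => sin (b * t) / b) (fun t => cos (b * t))).
    move=> t _; apply: is_derive_eq; rewrite /GRing.scale/=; field; exact: b0.
  apply: continuous_subspaceT => t.
  by apply: is_derive_continuous; apply: is_derive_eq.
have [K2 hK2] : exists K, forall s t : R, 0 <= s -> s <= t -> t <= 1 ->
    `|cos (b * t) - cos (b * s)| <= K * (t - s).
  apply: (@lipschitz_C1 _ (fun t => cos (b * t)) (fun t => - b * sin (b * t))).
    by move=> t _; apply: is_derive_eq; rewrite /GRing.scale/=; ring.
  apply: continuous_subspaceT => t.
  by apply: is_derive_continuous; apply: is_derive_eq.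
have [K3 hK3] : exists K, forall s t : R, 0 <= s -> s <= t -> t <= 1 ->
    `|(gamma x b c t).2 - (gamma x b c s).2| <= K * (t - s).
  apply: (@lipschitz_C1 _ (fun t => (gamma x b c t).2)
      (fun t => b * dot (gamma1 t) (gamma1 t))).
    by move=> t _; exact: is_derive_snd (is_derive_gamma t).
  apply: continuous_subspaceT => t.
  have -> : (fun t => b * dot (gamma1 t) (gamma1 t)) = (fun t =>
      b * ((sin (b * t) / b) ^+ 2 * dot c c
    + 2 * (sin (b * t) / b) * cos (b * t) * dot x c
    + cos (b * t) ^+ 2 * dot x x)).
    by apply/funext => s; rewrite dot_gamma1.
  by apply: is_derive_continuous; apply: is_derive_eq.
apply: (@abs_continuous01_lipschitz _ _ _ (K1 * `|c| + K2 * `|x| + K3)).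
move=> s t s0 st t1.
have ts : 0 <= t - s by rewrite subr_ge0.
have h3 := hK3 _ _ s0 st t1; have h1 := hK1 _ _ s0 st t1; have h2 := hK2 _ _ s0 st t1.
have h12 : `|(gamma x b c t).1 - (gamma x b c s).1| <= (K1 * `|c| + K2 * `|x|) * (t - s).
  rewrite !gamma_fst /gamma1 opprD addrACA -(scalerBl _ _ c) -(scalerBl _ _ x).
  rewrite (le_trans (ler_normD _ _))// (normrZ _ c) (normrZ _ x) mulrDl.
  have := lerD (ler_wpM2r (normr_ge0 c) h1) (ler_wpM2r (normr_ge0 x) h2).
  by rewrite (mulrAC K1) (mulrAC K2).
have K30 : 0 <= K3 * (t - s) by exact: le_trans h3.
have K10 : 0 <= (K1 * `|c| + K2 * `|x|) * (t - s) by exact: le_trans h12.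
rewrite prod_normE ge_max mulrDl; apply/andP; split.
  by rewrite (le_trans h12)// lerDl.
by rewrite (le_trans h3)// lerDr.
Qed.

End gamma.

(** * Uniqueness of geodesics *)

Section ode.
Variable R : realType.

(** The open interval serves quantities built from a derivative, about which nothing is known at the
    endpoints. *)
Lemma derive_eq0_cst_oo (f : R -> R) :
  (forall t : R, 0 < t < 1 -> is_derive t 1 f 0) ->
  forall s t : R, 0 < s < 1 -> 0 < t < 1 -> f s = f t.
Proof.
move=> df s t.
wlog st : s t / s < t.
  by move=> H s0 t0; have [st|st|->//] := ltgtP s t; [exact: H|apply/esym/H].
move=> /andP[s0 s1] /andP[t0 t1].
have [||c _] := @MVT R f (fun=> 0) s t st.
- by move=> c; rewrite in_itv/= => /andP[sc ct]; apply: df; lra.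
- apply: derivable_within_continuous => c; rewrite in_itv/= => /andP[sc ct].
  by have [] : is_derive c 1 f 0 by apply: df; lra.
by rewrite mul0r => /eqP; rewrite subr_eq0 => /eqP.
Qed.

Lemma derive_eq0_cst_cc (f : R -> R) :
  {within `[0, 1], continuous f} ->
  (forall t : R, 0 < t < 1 -> is_derive t 1 f 0) ->
  forall s t : R, 0 <= s <= 1 -> 0 <= t <= 1 -> f s = f t.
Proof.
move=> cf df s t.
wlog st : s t / s < t.
  by move=> H s0 t0; have [st|st|->//] := ltgtP s t; [exact: H|apply/esym/H].
move=> /andP[s0 s1] /andP[t0 t1].
have [||c _] := @MVT R f (fun=> 0) s t st.
- by move=> c; rewrite in_itv/= => /andP[sc ct]; apply: df; lra.
- by apply: continuous_subspaceW cf; apply: subset_itv; rewrite bnd_simp.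
by rewrite mul0r => /eqP; rewrite subr_eq0 => /eqP.
Qed.

Lemma harmonic_oscillator (y dy : R -> R) (l : R) : l != 0 ->
  {within `[0, 1], continuous y} ->
  (forall t : R, 0 < t < 1 -> is_derive t 1 y (dy t)) ->
  (forall t : R, 0 < t < 1 -> is_derive t 1 dy (- (l ^+ 2 * y t))) ->
  exists k : R, forall t : R, 0 <= t <= 1 ->
    y t = sin (l * t) / l * k + cos (l * t) * y 0.
Proof.
move=> l0 cy hy hdy.
(* A and B are the coefficients of cos and sin in the solution, recovered from (y, dy) by inverting
   a rotation; both have derivative 0. *)
pose A t := y t * cos (l * t) - dy t * (sin (l * t) / l).
pose B t := y t * sin (l * t) + dy t * (cos (l * t) / l).
have h01 : 0 < (2^-1 : R) < 1 by rewrite invr_gt0 ltr0n invf_lt1 ?ltr1n /=.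
have dA (t : R) : 0 < t < 1 -> is_derive t 1 A 0.
  move=> t01; have ht := hy t t01; have hdt := hdy t t01.
  rewrite /A; apply: is_derive_eq; rewrite /GRing.scale/=; field; exact: l0.
have dB (t : R) : 0 < t < 1 -> is_derive t 1 B 0.
  move=> t01; have ht := hy t t01; have hdt := hdy t t01.
  rewrite /B; apply: is_derive_eq; rewrite /GRing.scale/=; field; exact: l0.
have cA t (t01 : 0 < t < 1) := derive_eq0_cst_oo dA t01 h01.
have cB t (t01 : 0 < t < 1) := derive_eq0_cst_oo dB t01 h01.
set a := A _ in cA; set b := B _ in cB.
pose D t := y t - (a * cos (l * t) + b * sin (l * t)).
have yE (t : R) : 0 < t < 1 -> y t = a * cos (l * t) + b * sin (l * t).
  move=> t01; rewrite -(cA t t01) -(cB t t01) /A /B.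
  have Cs := cos2sin2 (l * t); field: Cs; exact: l0.
have dyE (t : R) : 0 < t < 1 -> dy t = b * l * cos (l * t) - a * l * sin (l * t).
  move=> t01; rewrite -(cA t t01) -(cB t t01) /A /B.
  have Cs := cos2sin2 (l * t); field: Cs; exact: l0.
(* Continuity of y carries the formula from the open interval to the endpoints, which identifies a
   with y 0. *)
have D0 (t : R) : 0 <= t <= 1 -> D t = 0.
  move=> t01; have -> : D t = D 2^-1; last by rewrite /D yE// subrr.
  apply: derive_eq0_cst_cc => //; last by lra.
    have ccs : {within `[0, 1],
        continuous (fun t => a * cos (l * t) + b * sin (l * t))}.
      apply: continuous_subspaceT => r.
      by apply: is_derive_continuous; is_derive_tac.
    by move=> s; exact: (continuousB (cy s) (ccs s)).
  move=> s s01; have ht := hy s s01.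
  by rewrite /D; apply: is_derive_eq; rewrite /GRing.scale/= dyE//; ring.
have a0 : a = y 0.
  have /eqP := D0 0 (ltac:(lra)); rewrite /D mulr0 cos0 sin0 mulr0 addr0 mulr1.
  by rewrite subr_eq0 => /eqP.
exists (l * b) => t t01; have /eqP := D0 t t01; rewrite /D subr_eq0 => /eqP ->.
by rewrite a0; field.
Qed.

End ode.

Section geodesic.
Variables (R : realType) (n : nat).
Implicit Types (x c : 'rV[R]_n) (g : R -> space R n).

Lemma gamma_0 x (b : R) c : b != 0 -> gamma x b c 0 = (x, 0).
Proof.
move=> b0; rewrite /gamma (negbTE b0) !mulr0 sin0 cos0; congr pair.
  by rewrite mul0r scale0r scale1r add0r.
by rewrite expr0n/=; ring.
Qed.

Lemma geodesic_gamma x g : geodesic g -> g 0 = (x, 0) -> (g 1).2 != 0 ->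
  exists (b : R) c, b != 0 /\ eq01 g (gamma x b c).
Proof.
move=> [cg [l [beta hg]]] g0 g1.
have dg (t : R) : 0 < t < 1 -> is_derive t 1 g (derive1 g t).
  move=> t01; have [dgt _ _ _ _] := hg t t01.
  by rewrite derive1E; exact: derivableP.
have c1 : {within `[0, 1], continuous (fun t => (g t).1)}.
  by move=> t; apply: (continuous_comp (cg t)); exact: cvg_fst.
have c2 : {within `[0, 1], continuous (fun t => (g t).2)}.
  by move=> t; apply: (continuous_comp (cg t)); exact: cvg_snd.
have du (t : R) : 0 < t < 1 ->
    is_derive t 1 (fun s => (g s).2) (l * dot (g t).1 (g t).1).
  move=> t01; have [_ _ u2 bE _] := hg t t01.
  by rewrite -dotZl -bE -u2; exact: is_derive_snd (dg t t01).
(* A zero multiplier gives u' = 0, so the curve could not leave height 0. *)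
have l0 : l != 0.
  apply: contraNneq g1 => l0.
  have -> : (g 1).2 = (g 0).2; last by rewrite g0.
  apply: (derive_eq0_cst_cc c2) => // [t t01||]; rewrite ?lexx ?ler01//.
  by have := du t t01; rewrite l0 mul0r.
have osc j : exists k : R, forall t : R, 0 <= t <= 1 ->
    (g t).1 0 j = sin (l * t) / l * k + cos (l * t) * (g 0).1 0 j.
  apply: (@harmonic_oscillator _ (fun t => (g t).1 0 j)
      (fun t => (derive1 g t).1 0 j)) => //.
  - move=> t; exact: (continuous_comp (c1 t) (@coord_continuous R 1 n 0 j _)).
  - by move=> t t01; exact: is_derive_coord (is_derive_fst (dg t t01)).
  - move=> t t01; have [_ d2 _ bE d2E] := hg t t01.
    have -> : - (l ^+ 2 * (g t).1 0 j)
        = derive1 (fun s => (derive1 g s).1) t 0 j.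
      by rewrite d2E bE !mxE expr2 mulrA.
    apply: is_derive_coord; rewrite derive1E; exact: derivableP.
have [c cE] := choice osc.
exists l, (\row_j c j).
have g1E (t : R) : 0 <= t <= 1 -> (g t).1 = gamma1 x l (\row_j c j) t.
  by move=> t01; apply/rowP => j; rewrite cE// g0 !mxE.
split => // t; rewrite in_itv/= => t01; apply/eqP.
rewrite -pair_eqE /= /pair_eq g1E// gamma_fst// eqxx/=.
pose D t := (g t).2 - (gamma x l (\row_j c j) t).2.
rewrite -subr_eq0 -/(D t).
have -> : D t = D 0; last by rewrite /D g0 gamma_0// subrr.
apply: derive_eq0_cst_cc => //; last by rewrite lexx ler01.
  have cgam : {within `[0, 1],
      continuous (fun t => (gamma x l (\row_j c j) t).2)}.
    apply: continuous_subspaceT => r.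
    exact: is_derive_continuous (is_derive_snd (is_derive_gamma _ _ l0 r)).
  by move=> s; exact: (continuousB (c2 s) (cgam s)).
move=> s s01.
have -> : 0 = l * dot (g s).1 (g s).1
    - l * dot (gamma1 x l (\row_j c j) s) (gamma1 x l (\row_j c j) s) :> R.
  by rewrite g1E ?subrr//; lra.
apply: is_derive_addf; first exact: du.
exact: is_derive_oppf (is_derive_snd (is_derive_gamma _ _ l0 s)).
Qed.

End geodesic.

(** * The end condition *)

Section endpoint.
Variables (R : realType) (n : nat) (x : 'rV[R]_n) (u : R).
Hypotheses (hx : x != 0) (hu : 0 < u).
Implicit Types (b s : R) (c : 'rV[R]_n).

Let a := u / enorm x ^+ 2.

Lemma enorm_sqr_gt0 : 0 < enorm x ^+ 2.
Proof. by rewrite enorm_sqr dot_gt0. Qed.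

Lemma enorm_neq0 : enorm x != 0.
Proof. by rewrite gt_eqF// enorm_gt0. Qed.

Lemma slope_gt0 : 0 < a.
Proof. by rewrite divr_gt0// enorm_sqr_gt0. Qed.

Lemma mu_solutionP b :
  mu_solution x u b <-> (sin (b / 2) != 0 /\ mu_root a (b / 2)).
Proof. exact: (mu_tilde_eqP slope_gt0). Qed.

Lemma mu_solution_gt0 b : mu_solution x u b -> 0 < b.
Proof.
move=> /mu_solutionP[sb /(mu_root_ge0 slope_gt0)].
rewrite le_eqVlt => /orP[/eqP b0|]; last by lra.
by move: sb; rewrite -b0 sin0 eqxx.
Qed.

Lemma gamma_cot_length b : sin (b / 2) != 0 ->
  enorm (- (b * cot (b / 2)) *: x) ^+ 2 + b ^+ 2 * enorm x ^+ 2
    = b ^+ 2 / sin (b / 2) ^+ 2 * enorm x ^+ 2.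
Proof.
move=> sb; rewrite enormZ exprMn real_normK ?num_real// /cot.
have Cs := cos2sin2 (b / 2); field: Cs; exact: sb.
Qed.

(** The root equation eliminates u; what remains is a rational identity in s, sin s and cos s modulo
    cos^2 s + sin^2 s = 1. *)
Lemma mu_solution_length b : mu_solution x u b ->
  b ^+ 2 / sin (b / 2) ^+ 2 * enorm x ^+ 2
    = 2 * b * u + 2 * enorm x ^+ 2 * b * cot (b / 2).
Proof.
move=> /mu_solutionP[sb]; set s := b / 2 => sE.
have x0 := enorm_sqr_gt0; have x0' := gt_eqF x0.
have bE : b = 2 * s by rewrite /s; field.
have -> : u = a * enorm x ^+ 2 by rewrite /a; field; exact: enorm_neq0.
have aE : a = (s - sin s * cos s) / sin s ^+ 2.
  by rewrite {1}sE; field.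
have Cs := cos2sin2 s; rewrite aE bE /cot; field: Cs; exact: sb.
Qed.

Lemma gamma_cot_end b : mu_solution x u b -> gamma_cot x b 1 = (- x, u).
Proof.
move=> bsol; have b0 := mu_solution_gt0 bsol.
move: bsol => /mu_solutionP[sb]; set s := b / 2 => sE.
have x0 := enorm_sqr_gt0.
have bE : b = 2 * s by rewrite /s; field.
have s0 : s != 0 by rewrite gt_eqF// /s; lra.
have uE : u = a * enorm x ^+ 2 by rewrite /a; field; exact: enorm_neq0.
have aE : a = (s - sin s * cos s) / sin s ^+ 2.
  by rewrite {1}sE; field.
have Cs := cos2sin2 s.
rewrite /gamma_cot /gamma gt_eqF// -/s !mulr1; congr pair.
  apply/rowP => j; rewrite !mxE /cot bE sin_mulr2 cos_mulr2.
  by field: Cs; rewrite sb s0.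
rewrite enormZ exprMn real_normK ?num_real// dotZr -enorm_sqr uE aE /cot.
rewrite (sin_mulr2 b) bE sin_mulr2 cos_mulr2.
by field: Cs; rewrite sb s0.
Qed.

(** At odd multiples of pi the term with c drops out of the first component, and the height depends
    on c only through |c|. *)
Lemma gamma_odd_end (m : nat) c : let b := (2 * m + 1)%:R * pi in
  b * enorm x ^+ 2 <= 2 * u ->
  enorm c = Num.sqrt (2 * b * u - b ^+ 2 * enorm x ^+ 2) ->
  gamma x b c 1 = (- x, u).
Proof.
move=> b bu cE; have p0 := @pi_gt0 R.
have b0 : 0 < b by rewrite mulr_gt0// ltr0n addn1.
have sb : sin b = 0 by exact: sin_natpi.
have cb : cos b = - 1.
  by rewrite /b cos_natpi exprD exprM sqrrN !expr1n mul1r expr1.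
have cE2 : enorm c ^+ 2 = 2 * b * u - b ^+ 2 * enorm x ^+ 2.
  rewrite cE sqr_sqrtr// subr_ge0.
  have : b * (b * enorm x ^+ 2) <= b * (2 * u) by rewrite ler_pM2l.
  by rewrite mulrA -expr2; lra.
rewrite /gamma gt_eqF// !mulr1 (sin_mulr2 b) sb cb; congr pair.
  by rewrite mul0r scale0r add0r scaleN1r.
by rewrite cE2; field; rewrite gt_eqF.
Qed.

Lemma gamma_end b c : b != 0 -> gamma x b c 1 = (- x, u) ->
  (mu_solution x u b /\ c = - (b * cot (b / 2)) *: x) \/
  (exists m : nat, let b' := (2 * m + 1)%:R * pi in
    [/\ b' * enorm x ^+ 2 <= 2 * u, b = b' &
        enorm c = Num.sqrt (2 * b' * u - b' ^+ 2 * enorm x ^+ 2)]).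
Proof.
move=> b0; rewrite /gamma (negbTE b0) !mulr1 => -[cx cu].
have x0 := enorm_sqr_gt0.
have xj : exists j, x 0 j != 0.
  apply/existsP; rewrite -negb_forall; apply: contra hx => /forallP x00.
  by apply/eqP/rowP => j; rewrite mxE; apply/eqP.
(* If sin b = 0, a nonzero coordinate of x forces cos b = -1; otherwise the first component
   determines c. *)
have [sb|sb] := eqVneq (sin b) 0; last left.
  right; have cb : cos b = - 1.
    have [j xj0] := xj; move/rowP: cx => /(_ j); rewrite !mxE sb mul0r mul0r add0r.
    by move=> h; apply: (mulIf xj0); rewrite mulN1r.
  move: cu; rewrite (sin_mulr2 b) sb !mulr0 expr0n/= => cu.
  have cE : enorm c ^+ 2 = 2 * b * u - b ^+ 2 * enorm x ^+ 2.
    by rewrite -cu; field.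
  have c0 : 0 <= enorm c ^+ 2 by exact: sqr_ge0.
  (* |c|^2 >= 0 gives 2 b u >= b^2 |x|^2 > 0, which excludes negative b. *)
  have bgt0 : 0 < b.
    have : 0 < b * u.
      have : 0 < b ^+ 2 * enorm x ^+ 2 by rewrite mulr_gt0// exprn_even_gt0.
      lra.
    by rewrite pmulr_lgt0.
  have [k bk] := sin_eq0_ge0 (ltW bgt0) sb.
  have kodd : odd k.
    move: cb; rewrite bk cos_natpi -signr_odd; case: odd => //= /eqP.
    by rewrite expr0 -subr_eq0 opprK -(natrD _ 1 1) pnatr_eq0.
  exists k./2; have -> : (2 * k./2 + 1)%N = k.
    by rewrite mul2n addn1 -[RHS]odd_double_half kodd.
  rewrite -bk; split => //; last by rewrite -cE sqrtr_sqr ger0_norm ?enorm_ge0.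
  rewrite -(ler_pM2l bgt0); move: c0; rewrite cE; lra.
have bE : b = 2 * (b / 2) by field.
set s := b / 2 in bE *.
have sb2 : sin b = 2 * sin s * cos s by rewrite bE sin_mulr2.
have ss : sin s != 0.
  by apply: contraNneq sb => s0; rewrite sb2 s0 mulr0 mul0r.
have cs : cos s != 0.
  by apply: contraNneq sb => s0; rewrite sb2 s0 mulr0.
have cb2 : cos b = 1 - 2 * sin s ^+ 2 by rewrite bE cos_mulr2.
have Cs := cos2sin2 s.
have s0 : s != 0 by apply: contraNneq b0 => s0; rewrite bE s0 mulr0.
have cE : c = - (b * cot s) *: x.
  apply/rowP => j; move/rowP: cx => /(_ j); rewrite !mxE => cxj.
  have -> : c 0 j = b / sin b * (sin b / b * c 0 j) by field; rewrite b0.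
  have -> : sin b / b * c 0 j = - x 0 j - cos b * x 0 j by rewrite -cxj; ring.
  rewrite cb2 sb2 /cot.
  have -> : - x 0 j - (1 - 2 * sin s ^+ 2) * x 0 j = - (2 * cos s ^+ 2) * x 0 j.
    by ring: Cs.
  by field; rewrite ss.
split => //; apply/mu_solutionP; rewrite -/s; split => //.
have uE : u = a * enorm x ^+ 2 by rewrite /a; field; exact: enorm_neq0.
have aE : a = (s - sin s * cos s) / sin s ^+ 2.
  rewrite /a -cu cE enormZ exprMn real_normK ?num_real// dotZr -enorm_sqr /cot.
  rewrite (sin_mulr2 b) sb2 cb2 bE.
  field: Cs; by rewrite ss s0 enorm_neq0.
rewrite /mu_root aE; field; exact: ss.
Qed.

End endpoint.

(** * Calibration by the action *)

Lemma is_derive_dot (R : realType) (n : nat) (f g : R -> 'rV[R]_n) (t : R) df dg :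
  is_derive t 1 f df -> is_derive t 1 g dg ->
  is_derive t 1 (fun s => dot (f s) (g s)) (dot df (g t) + dot (f t) dg).
Proof.
move=> hf hg; rewrite /dot -big_split/=.
have -> : (fun s => \sum_(j < n) f s 0 j * g s 0 j)
    = \sum_(j < n) (fun s => f s 0 j * g s 0 j).
  by apply/funext => s; rewrite fct_sumE.
by apply: is_derive_sum => j; apply: is_derive_mulf; exact: is_derive_coord.
Qed.

Lemma abs_continuous01_dot (R : realType) (n : nat) (f g : R -> 'rV[R]_n) :
  (forall j, abs_continuous01 (fun t => f t 0 j)) ->
  (forall j, abs_continuous01 (fun t => g t 0 j)) ->
  abs_continuous01 (fun t => dot (f t) (g t)).
Proof.
by move=> acf acg; apply: abs_continuous01_sum => j; exact: abs_continuous01_mul.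
Qed.

Lemma norm_coord_le (R : realType) (n : nat) (v : 'rV[R]_n) (j : 'I_n) :
  `|v 0 j| <= `|v|.
Proof.
rewrite [leRHS](mx_normrE v).
exact: (le_bigmax _ (fun ij : 'I_1 * 'I_n => `|v ij.1 ij.2|) (0, j)).
Qed.

Lemma abs_continuous01_fst (R : realType) (n : nat) (g : R -> space R n) :
  abs_continuous01 g -> forall j, abs_continuous01 (fun t => (g t).1 0 j).
Proof.
move=> acg j; apply: (@abs_continuous01_dominated _ _ _ _ _ 1) acg => s t _ _ _.
rewrite mul1r prod_normE le_max; apply/orP; left.
have -> : (g t).1 0 j - (g s).1 0 j = (g t - g s).1 0 j by rewrite !mxE.
exact: norm_coord_le.
Qed.

Lemma abs_continuous01_snd (R : realType) (n : nat) (g : R -> space R n) :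
  abs_continuous01 g -> abs_continuous01 (fun t => (g t).2).
Proof.
apply: (@abs_continuous01_dominated _ _ _ _ _ 1) => s t _ _ _.
by rewrite mul1r prod_normE le_max lexx orbT.
Qed.

Section calibration.
Variables (R : realType) (b : R).
Hypothesis b0pi : 0 < b < pi.
Implicit Types t : R.

(** An arc of length b centred at pi/2: for b < pi it stays inside (0, pi), where the sine does not
    vanish. *)
Definition phase t := b * t + (pi - b) / 2.
Definition cal_w t := b * cos (phase t) / sin (phase t).
(** The factor b / sin(b/2) makes [cal_w 0 + cal_p 0] equal to - b cot(b/2): at the start, half the
    y-gradient of S is the initial velocity of gamma^b. *)
Definition cal_p t := - (b / sin (b / 2)) / sin (phase t).
Definition cal_q t := b / sin (b / 2) ^+ 2 * (cos (phase t) / sin (phase t)).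

Lemma sin_phase_gt0 t : 0 <= t <= 1 -> 0 < sin (phase t).
Proof.
move: b0pi => /andP[b0 bpi] /andP[t0 t1]; apply: sin_gt0_pi.
have : 0 <= b * t by rewrite mulr_ge0// ltW.
have : b * t <= b by rewrite ler_piMr// ltW.
by rewrite /phase; lra.
Qed.

Lemma sin_half_gt0 : 0 < sin (b / 2).
Proof. by apply: sin_gt0_pi; move: b0pi; have := @pi_gt0 R; lra. Qed.

Lemma cos_half_gt0 : 0 < cos (b / 2).
Proof. by apply: cos_gt0_pihalf; move: b0pi; lra. Qed.

Lemma is_derive_phase t : is_derive t 1 phase b.
Proof. by apply: is_derive_eq; rewrite /GRing.scale/=; ring. Qed.

Lemma is_derive_invsin_phase t : 0 <= t <= 1 ->
  is_derive t 1 (fun s => (sin (phase s))^-1)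
    (- (cos (phase t) * b) / sin (phase t) ^+ 2).
Proof.
move=> t01; apply: is_derive_invf; first by rewrite gt_eqF// sin_phase_gt0.
exact: is_derive_sinf (is_derive_phase t).
Qed.

Lemma is_derive_cal_w t : 0 <= t <= 1 ->
  is_derive t 1 cal_w (- (b ^+ 2 + cal_w t ^+ 2)).
Proof.
move=> t01; have hv := is_derive_invsin_phase t01; have hp := is_derive_phase t.
have sp : sin (phase t) != 0 by rewrite gt_eqF// sin_phase_gt0.
have Cs := cos2sin2 (phase t).
rewrite /cal_w; apply: is_derive_eq; rewrite /GRing.scale/=; field: Cs; exact: sp.
Qed.

Lemma is_derive_cal_p t : 0 <= t <= 1 ->
  is_derive t 1 cal_p (- (cal_w t * cal_p t)).
Proof.
move=> t01; have hv := is_derive_invsin_phase t01.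
have sp : sin (phase t) != 0 by rewrite gt_eqF// sin_phase_gt0.
have sh : sin (b / 2) != 0 by rewrite gt_eqF// sin_half_gt0.
rewrite /cal_w /cal_p; apply: is_derive_eq; rewrite /GRing.scale/=; field.
by rewrite sp sh.
Qed.

Lemma is_derive_cal_q t : 0 <= t <= 1 ->
  is_derive t 1 cal_q (- cal_p t ^+ 2).
Proof.
move=> t01; have hv := is_derive_invsin_phase t01; have hp := is_derive_phase t.
have sp : sin (phase t) != 0 by rewrite gt_eqF// sin_phase_gt0.
have sh : sin (b / 2) != 0 by rewrite gt_eqF// sin_half_gt0.
have Cs := cos2sin2 (phase t).
rewrite /cal_q /cal_p; apply: is_derive_eq; rewrite /GRing.scale/=; field: Cs.
by rewrite sp sh.
Qed.

Lemma abs_continuous01_compD (f df g : R -> R) :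
  (forall t : R, 0 <= t <= 1 -> is_derive t 1 f (df t)) ->
  (forall t : R, 0 <= t <= 1 -> derivable df t 1) ->
  (forall s t : R, 0 <= s -> s <= t -> t <= 1 ->
    [/\ 0 <= g s, g s <= g t & g t <= 1]) ->
  abs_continuous01 g -> abs_continuous01 (fun t => f (g t)).
Proof.
move=> hf hdf; apply: (abs_continuous01_comp hf).
by apply: derivable_within_continuous => t; rewrite in_itv/= => /hdf.
Qed.

Lemma is_derive_derivable (f : R -> R) t df : is_derive t 1 f df -> derivable f t 1.
Proof. by case. Qed.

Variable tau : R -> R.
Hypothesis tau01 : forall s t : R, 0 <= s -> s <= t -> t <= 1 ->
  [/\ 0 <= tau s, tau s <= tau t & tau t <= 1].
Hypothesis actau : abs_continuous01 tau.

Lemma abs_continuous01_cal_w : abs_continuous01 (fun t => cal_w (tau t)).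
Proof.
refine (@abs_continuous01_compD cal_w (fun t => - (b ^+ 2 + cal_w t ^+ 2)) tau
  (@is_derive_cal_w) _ (@tau01) actau).
move=> t t01.
have := is_derive_cal_w t01 => ?.
by apply: is_derive_derivable; is_derive_tac.
Qed.

Lemma abs_continuous01_cal_p : abs_continuous01 (fun t => cal_p (tau t)).
Proof.
refine (@abs_continuous01_compD cal_p (fun t => - (cal_w t * cal_p t)) tau
  (@is_derive_cal_p) _ (@tau01) actau).
move=> t t01.
have := is_derive_cal_w t01; have := is_derive_cal_p t01 => ? ?.
by apply: is_derive_derivable; is_derive_tac.
Qed.

Lemma abs_continuous01_cal_q : abs_continuous01 (fun t => cal_q (tau t)).
Proof.
refine (@abs_continuous01_compD cal_q (fun t => - cal_p t ^+ 2) tau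
  (@is_derive_cal_q) _ (@tau01) actau).
move=> t t01.
have := is_derive_cal_p t01 => ?.
by apply: is_derive_derivable; is_derive_tac.
Qed.

Variables (n : nat) (x : 'rV[R]_n) (u : R).

(* [2 b v + cal_w tau |y|^2 + 2 cal_p tau (x . y) + cal_q tau |x|^2] solves the
   Hamilton-Jacobi equation [S_tau + |S_y|^2 / 4 + b^2 |y|^2 = 0]. *)
Definition action (tau : R) (y : space R n) : R :=
  2 * b * y.2 + cal_w tau * dot y.1 y.1 + 2 * cal_p tau * dot x y.1
    + cal_q tau * dot x x.

Lemma action_ends : action 1 (- x, u) - action 0 (x, 0)
  = 2 * b * u + 2 * enorm x ^+ 2 * b * cot (b / 2).
Proof.
have [s0 c0] := (gt_eqF sin_half_gt0, gt_eqF cos_half_gt0).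
have ph0 : phase 0 = pi / 2 - b / 2 by rewrite /phase; field.
have ph1 : phase 1 = b / 2 + pi / 2 by rewrite /phase; field.
have sin0E : sin (phase 0) = cos (b / 2).
  by rewrite ph0 sinB sin_pihalf cos_pihalf; ring.
have cos0E : cos (phase 0) = sin (b / 2).
  by rewrite ph0 cosB sin_pihalf cos_pihalf; ring.
have sin1E : sin (phase 1) = cos (b / 2) by rewrite ph1 sinDpihalf.
have cos1E : cos (phase 1) = - sin (b / 2) by rewrite ph1 cosDpihalf.
rewrite /action /cal_w /cal_p /cal_q sin0E cos0E sin1E cos1E /=.
rewrite !dotNl !dotNr enorm_sqr /cot.
have Cs := cos2sin2 (b / 2).
field: Cs; by rewrite s0 c0.
Qed.

Lemma action_bound (g : R -> space R n) (M : R) (N : set R) :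
  abs_continuous01 g ->
  (@lebesgue_measure R).-negligible N ->
  (forall t : R, 0 < t < 1 -> ~ N t ->
    [/\ derivable g t 1, in_hspan (g t) (derive1 g t), derivable tau t 1,
        0 < derive1 tau t &
        dot (derive1 g t).1 (derive1 g t).1
          + (derive1 g t).2 ^+ 2 / dot (g t).1 (g t).1
        <= M * derive1 tau t ^+ 2]) ->
  action (tau 1) (g 1) - action (tau 0) (g 0) <= M * (tau 1 - tau 0).
Proof.
move=> acg Nnegl hN.
pose h t := action (tau t) (g t) - M * tau t.
suff : h 1 <= h 0 by rewrite /h mulrBr; lra.
have acg1 := abs_continuous01_fst acg.
have acg2 := abs_continuous01_snd acg.
apply: (@ac_nonincreasing _ h N) => //.
  apply: abs_continuous01_add; last first.
    have -> : (fun t => - (M * tau t)) = (fun t => - M * tau t).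
      by apply/funext => t; rewrite mulNr.
    exact: abs_continuous01_mul (abs_continuous01_cst _) actau.
  apply: abs_continuous01_add; last first.
    exact: abs_continuous01_mul abs_continuous01_cal_q (abs_continuous01_cst _).
  apply: abs_continuous01_add; last first.
    apply: abs_continuous01_mul; last first.
      by apply: abs_continuous01_dot => // j; exact: abs_continuous01_cst.
    exact: abs_continuous01_mul (abs_continuous01_cst _) abs_continuous01_cal_p.
  apply: abs_continuous01_add.
    exact: abs_continuous01_mul (abs_continuous01_cst _) acg2.
  apply: abs_continuous01_mul abs_continuous01_cal_w _.
  exact: abs_continuous01_dot.
move=> t t01 Nt; have [dg [al [be hsp]] dtau tau'0 hM] := hN t t01 Nt.
have {}dg : is_derive t 1 g (derive1 g t) by rewrite derive1E; exact: derivableP.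
have {}dtau : is_derive t 1 tau (derive1 tau t).
  by rewrite derive1E; exact: derivableP.
have tau_t : 0 <= tau t <= 1.
  have /andP[t0 t1] := t01.
  by have [? ? ?] := tau01 (ltW t0) (lexx t) (ltW t1); apply/andP.
have dw : is_derive t 1 (fun s => cal_w (tau s)) _ :=
  is_derive1_comp (is_derive_cal_w tau_t) dtau.
have dp : is_derive t 1 (fun s => cal_p (tau s)) _ :=
  is_derive1_comp (is_derive_cal_p tau_t) dtau.
have dq : is_derive t 1 (fun s => cal_q (tau s)) _ :=
  is_derive1_comp (is_derive_cal_q tau_t) dtau.
have d2 := is_derive_snd dg.
have dgg := is_derive_dot (is_derive_fst dg) (is_derive_fst dg).
have dxg := is_derive_dot (is_derive_cst x t 1) (is_derive_fst dg).
move: hM dg d2 dgg dxg; rewrite hsp hcombE /=.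
set y := (g t).1; set r := derive1 tau t in tau'0 dtau dw dp dq *.
set w := cal_w (tau t) in dw dp *; set p := cal_p (tau t) in dp dq *.
move=> hM _ d2 dgg dxg.
pose h' := 2 * b * dot be y + (- (b ^+ 2 + w ^+ 2) * r * dot y y + w * (dot al y + dot y al))
  + 2 * (- (w * p) * r * dot x y + p * dot x al) + - p ^+ 2 * r * dot x x - M * r.
have dh : is_derive t 1 h h'.
  rewrite /h /action; apply: is_derive_eq.
  by rewrite /h' /GRing.scale /= dot0l /cst -/w -/p -/y; ring.
have [dh1 ->] := derive1_val dh; split => //.
(* After multiplication by r = tau' the inequality splits into two completed squares, [sq1] in alpha
   and [sq2] in beta; z is half the y-gradient of S. *)
rewrite -(pmulr_rle0 _ tau'0).
pose z := w *: y + p *: x.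
have sq1 : 0 <= dot al al - 2 * r * (w * dot y al + p * dot x al)
    + r ^+ 2 * (w ^+ 2 * dot y y + 2 * w * p * dot x y + p ^+ 2 * dot x x).
  have -> : dot al al - 2 * r * (w * dot y al + p * dot x al)
    + r ^+ 2 * (w ^+ 2 * dot y y + 2 * w * p * dot x y + p ^+ 2 * dot x x)
    = dot (al - r *: z) (al - r *: z); last exact: dot_ge0.
  rewrite /z dotDl !dotDr !dotNl !dotNr !dotZl !dotZr !dotDl !dotDr !dotZl !dotZr.
  by rewrite (dotC al y) (dotC al x) (dotC y x); ring.
have sq2 : 2 * b * dot be y * r - b ^+ 2 * r ^+ 2 * dot y y
    <= dot be y ^+ 2 / dot y y.
  have [y0|y0] := eqVneq y 0.
    by rewrite y0 (dotC be) !dot0l; lra.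
  rewrite -subr_ge0.
  have -> : dot be y ^+ 2 / dot y y
      - (2 * b * dot be y * r - b ^+ 2 * r ^+ 2 * dot y y)
      = (dot be y / dot y y - b * r) ^+ 2 * dot y y.
    by field; rewrite dot_eq0.
  by rewrite mulr_ge0 ?sqr_ge0// dot_ge0.
rewrite /h' (dotC al y); lra.
Qed.
End calibration.

(** * Primitives and measurability of derivatives *)

(* No measurability: the integral of a nonnegative function is a supremum over
   the simple functions below it. *)
Lemma ge0_le_integral_lower d (T : measurableType d) (R : realType)
    (mu : {measure set T -> \bar R}) (D : set T) (f g : T -> \bar R) :
  (forall t, D t -> 0 <= f t)%E -> (forall t, D t -> f t <= g t)%E ->
  (\int[mu]_(t in D) f t <= \int[mu]_(t in D) g t)%E.
Proof.
move=> f0 fg; have g0 t : D t -> (0 <= g t)%E.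
  by move=> Dt; exact: le_trans (f0 t Dt) (fg t Dt).
rewrite !ge0_integralE//; apply: le_ereal_sup => _ [h hf <-]; exists h => // t.
apply: le_trans (hf t) _; rewrite !patchE; case: ifPn => // Dt.
by apply: fg; rewrite inE in Dt.
Qed.

Section primitive.
Variables (R : realType) (phi : R -> R).
Let mu := @lebesgue_measure R.
Hypothesis phi_int : mu.-integrable setT (EFin \o phi).
Hypothesis phi_ge0 : forall t, 0 <= phi t.

Definition primitive (y : R) : R := (\int[mu]_(t in `[0%R, y]) phi t)%R.

Let phi_intS (D : set R) : measurable D -> mu.-integrable D (EFin \o phi).
Proof. by move=> mD; exact: integrableS phi_int. Qed.

Lemma primitiveB (s t : R) : 0 <= s -> s <= t ->
  primitive t - primitive s = (\int[mu]_(y in `]s, t[) phi y)%R.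
Proof.
move=> s0 st; rewrite /primitive Rintegral_itvB ?bnd_simp//; last exact: phi_intS.
by rewrite Rintegral_itv_bndo_bndc//; exact: phi_intS.
Qed.

Lemma primitive_le (s t : R) : 0 <= s -> s <= t -> primitive s <= primitive t.
Proof.
by move=> s0 st; rewrite -subr_ge0 primitiveB//; apply: Rintegral_ge0.
Qed.

(** The integral of phi is small over any set of small measure; this is applied to the union of the
    intervals. *)
Lemma abs_continuous01_primitive : abs_continuous01 primitive.
Proof.
move=> e e0; have [d [d0 hd]] := integral_normr_continuous phi_int e0.
exists d => // m s t st dis sd.
pose U := \big[setU/set0]_(i < m) `]s i, t i[%classic.
have mU : measurable U by exact: bigsetU_measurable.
have muU : (mu U < d%:E)%E.
  rewrite /mu measure_bigsetU_ord//=.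
  rewrite (eq_bigr (fun i => (t i - s i)%:E)) ?sumEFin ?lte_fin// => i _.
  have [_ siti _] := st i; rewrite lebesgue_measure_itv/= lte_fin.
  by case: ltP => // tisi; have -> : t i = s i; [lra | rewrite subrr].
have := hd U mU muU; rewrite -!lte_fin; apply: le_lt_trans.
rewrite fineK; last first.
  apply: integrable_fin_num => //.
  exact: (integrable_abse (phi_intS mU)).
rewrite -sumEFin ge0_integral_bigsetU//; last 3 first.
- by rewrite index_enum_uniq.
- exact: sub_trivIset dis.
- apply: measurableT_comp => //; apply: measurableT_comp => //.
  have /integrableP[/measurable_EFinP + _] := phi_int.
  exact: measurable_funTS.
apply: lee_sum => i _; have [s0 siti _] := st i.
rewrite primitiveB// ger0_norm; last exact: Rintegral_ge0.
rewrite fineK; last by apply: integrable_fin_num => //; exact: phi_intS.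
apply: ge0_le_integral_lower => y _; rewrite lee_fin//.
exact: ler_norm.
Qed.

Lemma derivable_primitive :
  {ae mu, forall t, 0 < t -> derivable primitive t 1 /\ derive1 primitive t = phi t}.
Proof.
have loc := open_integrable_locally openT phi_int.
have := FTC1 (a := BLeft 0) (fun y => phi_intS (measurable_itv _)) loc.
apply: filterS; first exact: (ae_filter_ringOfSetsType mu).
move=> t ht t0; apply: ht.
by rewrite lte_fin.
Qed.

End primitive.

Section measurable_derivative.
Variables (R : realType) (f : R -> R).
Hypothesis acf : abs_continuous01 f.

(** [f] is arbitrary off [0, 1]; composing with the clamp makes it continuous, hence measurable, and
    preserves it on [0, 1]. *)
Let clamp (t : R) := Num.max 0 (Num.min 1 t).

Let continuous_clamp : continuous (f \o clamp).
Proof.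
have clamp01 t : 0 <= clamp t <= 1.
  by rewrite /clamp le_max lexx ge_max ler01 ge_min lexx.
have clamp_lip s t : s <= t -> 0 <= clamp t - clamp s <= t - s.
  move=> st; rewrite /clamp.
  by case: (leP 1 s) => ?; case: (leP 1 t) => ?; case: (leP (0 : R) 1) => ?;
    case: (leP 0 s) => ?; case: (leP 0 t) => ?; lra.
move=> t; apply/cvgrPdist_lt => e e0; have [d d0 fd] := acf e0.
have fd' r s : r <= s -> s - r < d -> `|f (clamp s) - f (clamp r)| < e.
  move=> rs srd; have /andP[c0 c1] := clamp_lip r s rs.
  have := fd 1%N (fun=> clamp r) (fun=> clamp s).
  rewrite !big_ord_recl !big_ord0 !addr0; apply.
  - by move=> _; have := clamp01 r; have := clamp01 s; split; lra.
  - by move=> i j _ _ _; rewrite !ord1.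
  - exact: le_lt_trans srd.
near=> s; have sd : `|t - s| < d.
  by near: s; apply/nbhs_ballP; exists d.
have [ts|st] := leP t s.
  by rewrite distrC; apply: fd' => //; move: sd; rewrite ltr_norml; lra.
by apply: fd'; [exact: ltW | move: sd; rewrite ltr_norml; lra].
Unshelve. all: by end_near. Qed.

Lemma measurable_abs_continuous01 (D : set R) :
  (forall t, D t -> 0 < t < 1) -> measurable_fun D f.
Proof.
move=> hD; apply: (eq_measurable_fun (f \o clamp)).
  move=> t /set_mem/hD/andP[t0 t1] /=.
  by rewrite /clamp min_r ?max_r// ltW.
by apply: measurable_funTS; exact: continuous_measurable_fun continuous_clamp.
Qed.

Lemma measurable_derive1 (D : set R) : measurable D ->
  (forall t, D t -> 0 < t < 1 /\ derivable f t 1) ->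
  measurable_fun D (derive1 f).
Proof.
move=> mD hD.
pose h (m : nat) (t : R) :=
  m.+1%:R * ((f \o clamp) (t + m.+1%:R^-1) - (f \o clamp) t).
apply: (@measurable_fun_cvg _ _ _ _ h).
  move=> m; apply: measurable_funTS; apply: continuous_measurable_fun => t.
  apply: cvgM; first exact: cvg_cst.
  apply: cvgB; last exact: continuous_clamp.
  apply: (@cvg_comp _ _ _ (fun t => t + m.+1%:R^-1) (f \o clamp) _ (nbhs (t + m.+1%:R^-1))).
    by apply: cvgD; [exact: cvg_id | exact: cvg_cst].
  exact: continuous_clamp.
move=> t Dt; have [/andP[t0 t1] dft] := hD t Dt.
have /is_derive_cvgP : is_derive t 1 f (derive1 f t).
  by rewrite derive1E; exact: derivableP.
move=> /cvgrPdist_lt df; apply/cvgrPdist_lt => e e0.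
have := df e e0; rewrite near_withinE => /nbhs_ballP[r /= r0 hr].
(* Steps below 1 - t keep the difference quotient inside [0, 1], where the clamp has no effect. *)
have rt0 : 0 < Num.min r (1 - t) by rewrite lt_min r0 subr_gt0.
have [N _ hN] : \forall m \near \oo, m.+1%:R^-1 < Num.min r (1 - t).
  exact: near_infty_natSinv_lt (PosNum rt0).
exists N => // m Nm.
have := hN m Nm; rewrite /= lt_min => /andP[mr mt].
have m0 : 0 < m.+1%:R^-1 :> R by rewrite invr_gt0.
have := hr m.+1%:R^-1; rewrite /ball/= sub0r normrN gtr0_norm// => /(_ mr).
rewrite gt_eqF// => /(_ isT); rewrite invrK /h /= /clamp.
have -> : Num.max 0 (Num.min 1 t) = t by rewrite min_r ?max_r// ltW.
have -> : Num.max 0 (Num.min 1 (t + m.+1%:R^-1)) = t + m.+1%:R^-1.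
  move: m0 mt; set k := _^-1 => m0 mt.
  have tk0 : 0 <= t + k by lra.
  have tk1 : t + k <= 1 by lra.
  by rewrite min_r// max_r.
by rewrite (addrC t).
Qed.

End measurable_derivative.

(** * Lower bound on the length *)

Section lower_bound.
Variables (R : realType) (n : nat) (g : R -> space R n).
Hypothesis hg : horizontal g.
Let mu := @lebesgue_measure R.

Definition speed (t : R) : R :=
  Num.sqrt (dot (derive1 g t).1 (derive1 g t).1
    + (derive1 g t).2 ^+ 2 / dot (g t).1 (g t).1).

Lemma measurable_speed (D : set R) : measurable D ->
  (forall t, D t -> 0 < t < 1 /\ derivable g t 1) -> measurable_fun D speed.
Proof.
move=> mD hD; have D01 t : D t -> 0 < t < 1 by case/hD.
have dg t : D t -> is_derive t 1 g (derive1 g t).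
  by move=> /hD[_ dg]; rewrite derive1E; exact: derivableP.
have mdot (v w : R -> 'rV[R]_n) : (forall j, measurable_fun D (fun t => v t 0 j)) ->
    (forall j, measurable_fun D (fun t => w t 0 j)) ->
    measurable_fun D (fun t => dot (v t) (w t)).
  move=> mv mw; apply: measurable_sum => j; exact: measurable_funM.
have md1 j : measurable_fun D (fun t => (derive1 g t).1 0 j).
  apply: (eq_measurable_fun (derive1 (fun t => (g t).1 0 j))).
    move=> t /set_mem Dt.
    by rewrite (derive1_val (is_derive_coord j (is_derive_fst (dg t Dt)))).2.
  apply: (measurable_derive1 (abs_continuous01_fst hg.1 j)) => // t Dt; split; first exact: D01.
  by case: (is_derive_coord j (is_derive_fst (dg t Dt))).
have md2 : measurable_fun D (fun t => (derive1 g t).2).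
  apply: (eq_measurable_fun (derive1 (fun t => (g t).2))).
    by move=> t /set_mem Dt; rewrite (derive1_val (is_derive_snd (dg t Dt))).2.
  apply: (measurable_derive1 (abs_continuous01_snd hg.1)) => // t Dt; split; first exact: D01.
  by case: (is_derive_snd (dg t Dt)).
have mx : measurable_fun D (fun t => dot (g t).1 (g t).1).
  by apply: mdot => j;
    apply: (measurable_abs_continuous01 (abs_continuous01_fst hg.1 j)).
have msqrt : measurable_fun setT (@Num.sqrt R).
  by apply: continuous_measurable_fun; exact: sqrt_continuous.
apply: (measurableT_comp msqrt).
apply: measurable_funD; first exact: mdot.
apply: measurable_funM; first exact: measurable_funX.
have -> : (fun t => (dot (g t).1 (g t).1)^-1)
    = (fun t => dot (g t).1 (g t).1 `^ (-1)).
  by apply/funext => t; rewrite powR_inv1// dot_ge0.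
exact: (measurableT_comp (measurable_powR (-1)) mx).
Qed.

Lemma cc_norm_speed t : in_hspan (g t) (derive1 g t) ->
  cc_norm (g t) (derive1 g t) = (speed t)%:E.
Proof.
move=> [al [be hsp]]; rewrite /speed hsp hcombE cc_norm_hcomb.
by [].
Qed.

(** With tau' = (phi + k) / (La + k) the squared speed phi^2 is at most (La + k)^2 tau'^2, so
    [action_bound] applies with M = (La + k)^2. *)
Lemma energy_le_sqr_length (x : 'rV[R]_n) (u b : R) :
  0 < b < pi -> connects (x, 0) (- x, u) g -> forall l : R,
  cc_length g = l%:E ->
  2 * b * u + 2 * enorm x ^+ 2 * b * cot (b / 2) <= l ^+ 2.
Proof.
move=> b0pi [g0 g1] l lE.
have [acg [A [mA A0 hA]]] := hg.
pose D := `]0, 1[%classic `\` A.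
have mD : measurable D by exact: measurableD.
have hD t : D t -> [/\ 0 < t < 1, derivable g t 1 & in_hspan (g t) (derive1 g t)].
  case=> /=; rewrite in_itv/= => t01 nAt.
  have : (t \in `[0, 1] -> derivable g t 1 /\ in_hspan (g t) (derive1 g t)).
    apply: contrapT => nt; apply: nAt; exact: hA.
  have /andP[t0 t1] := t01.
  by rewrite in_itv/= !ltW// => /(_ isT)[dgt hsp].
(* a measurable minorant of the speed, which itself need not be measurable *)
pose phi := speed \_ D.
have phi0 t : 0 <= phi t by rewrite /phi patchE; case: ifP => // _; exact: sqrtr_ge0.
have mphi : measurable_fun setT phi.
  apply: (iffLR (measurable_restrictT speed mD)).
  by apply: measurable_speed mD _ => t /hD[].
have phiT :
    (\int[mu]_t (phi t)%:E = \int[mu]_(t in `[0%R, 1%R]) (phi t)%:E)%E.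
  rewrite [RHS]integral_mkcond; apply: eq_integral => t _.
  rewrite patchE; case: ifPn => // t01; rewrite /phi patchE ifN//.
  apply: contra t01 => /set_mem/hD[/andP[t0 t1] _ _].
  by rewrite inE/= in_itv/= !ltW.
have phil : (\int[mu]_(t in `[0%R, 1%R]) (phi t)%:E <= l%:E)%E.
  rewrite -lE /cc_length.
  apply: ge0_le_integral_lower => t t01; first by rewrite lee_fin.
  rewrite /phi patchE; case: ifPn => [/set_mem/hD[_ _ hsp]|_].
    by rewrite cc_norm_speed.
  exact: sqrte_ge0.
have int_phi : mu.-integrable setT (EFin \o phi).
  apply/integrableP; split; first exact/measurable_EFinP.
  apply: (@le_lt_trans _ _ l%:E); last exact: ltry.
  apply: le_trans phil; rewrite -phiT.
  by apply: ge0_le_integral_lower => t _ //=; rewrite ger0_norm.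
pose F := primitive phi.
pose La := F 1.
have La_le : La <= l.
  rewrite -lee_fin fineK//; apply: integrable_fin_num => //.
  exact: integrableS int_phi.
have La0 : 0 <= La by apply: Rintegral_ge0.
have F0 : F 0 = 0.
  by rewrite /F /primitive set_itv1 Rintegral_set1.
apply/ler_addgt0Pl => e e0.
(* For k <= 1 one has 2 La k + k^2 <= k (2 La + 1), which is why k is chosen at most e / (2 La +
   1). *)
suff H (k : R) : 0 < k ->
  2 * b * u + 2 * enorm x ^+ 2 * b * cot (b / 2) <= (La + k) ^+ 2.
  have k0 : 0 < Num.min 1 (e / (2 * La + 1)).
    by rewrite lt_min ltr01 divr_gt0//; lra.
  apply: le_trans (H _ k0) _; set k := Num.min _ _ in k0 *.
  have k1 : k <= 1 by rewrite ge_min lexx.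
  have ke : k * (2 * La + 1) <= e.
    by rewrite -ler_pdivlMr ?ge_min ?lexx ?orbT//; lra.
  have kk : k * k <= k by rewrite ler_piMr// ltW.
  have LaLa : La ^+ 2 <= l ^+ 2 by rewrite ler_pXn2r// nnegrE (le_trans La0).
  by rewrite sqrrD expr2 -mulr_natr; lra.
move=> k0.
have Lk0 : 0 < La + k by lra.
(* normalised arc length, perturbed by k so that its derivative is positive *)
pose tau t := (F t + k * t) / (La + k).
have [A' [mA' A'0 hA']] := derivable_primitive int_phi.
rewrite -action_ends//.
have tau0E : tau 0 = 0 by rewrite /tau F0 mulr0 addr0 mul0r.
have tau1E : tau 1 = 1 by rewrite /tau mulr1 divff// gt_eqF.
have tau01 s t : 0 <= s -> s <= t -> t <= 1 ->
    [/\ 0 <= tau s, tau s <= tau t & tau t <= 1].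
  have tau_le r r' : 0 <= r -> r <= r' -> tau r <= tau r'.
    move=> r0 rr'; rewrite /tau ler_pM2r ?invr_gt0// lerD//.
      exact: primitive_le.
    by rewrite ler_pM2l.
  move=> s0 st t1; split; last 1 first.
  - by rewrite -tau1E tau_le// (le_trans s0 st).
  - by rewrite -tau0E tau_le.
  - exact: tau_le.
have actau : abs_continuous01 tau.
  have ack := abs_continuous01_mul (abs_continuous01_cst k) (@abs_continuous01_id R).
  have acF := abs_continuous01_primitive int_phi phi0.
  exact: abs_continuous01_mul (abs_continuous01_add acF ack) (abs_continuous01_cst _).
have := @action_bound R b b0pi tau tau01 actau n x g ((La + k) ^+ 2) (A `|` A').
rewrite tau0E tau1E subr0 mulr1 g0 g1; apply => //.
- by apply: negligibleU; [exists A; split | exists A'; split].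
move=> t t01 nAA'.
have Dt : D t by split=> [|At]; [|apply: nAA'; left].
have [_ dgt hsp] := hD t Dt.
have [dF F'E] : derivable F t 1 /\ derive1 F t = phi t.
  apply: contrapT => nt; apply: nAA'; right; apply: hA' => /=.
  by move/(_ (ltac:(by case/andP: t01))).
have dF' : is_derive t 1 F (phi t).
  by rewrite -F'E derive1E; exact: derivableP.
have dtau : is_derive t 1 tau ((phi t + k) / (La + k)).
  rewrite /tau; apply: is_derive_eq; rewrite /GRing.scale/=; ring.
have [dtau1 ->] := derive1_val dtau; split => //.
  by rewrite divr_gt0// ltr_wpDl.
have -> : dot (derive1 g t).1 (derive1 g t).1
    + (derive1 g t).2 ^+ 2 / dot (g t).1 (g t).1 = phi t ^+ 2.
  rewrite /phi patchE mem_set// sqr_sqrtr// addr_ge0 ?dot_ge0//.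
  by rewrite divr_ge0 ?sqr_ge0 ?dot_ge0.
rewrite expr_div_n mulrC divfK ?expf_neq0 ?gt_eqF//.
by rewrite ler_pXn2r ?nnegrE ?phi0//; have := phi0 t; lra.
Qed.

End lower_bound.

(** * Geodesics between (x, 0) and (-x, u) *)

Lemma cc_length_ge0 (R : realType) (n : nat) (g : R -> space R n) :
  (0 <= cc_length g)%E.
Proof. by apply: integral_ge0 => t _; exact: sqrte_ge0. Qed.

(** Curves equal on [0, 1] may have different derivatives at 0 and 1. Dropping the endpoints
    requires a measurable integrand, which the constant speed provides. *)
Lemma eq01_cc_length (R : realType) (n : nat) (g h : R -> space R n) (r : R) :
  eq01 g h -> (forall t, cc_norm (h t) (derive1 h t) = r%:E) ->
  cc_length g = cc_length h.
Proof.
move=> gh hr.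
have gr : {in `]0, 1[%classic : set R,
    (fun=> r%:E) =1 (fun t => cc_norm (g t) (derive1 g t))}.
  move=> t; rewrite inE/= => t01; have /andP[t0 t1] : 0 < t < 1 by rewrite in_itv in t01.
  have -> : derive1 g t = derive1 h t.
    rewrite !derive1E; apply: near_eq_derive.
    have : nbhs t (`]0, 1[%classic : set R).
      by apply: open_nbhs_nbhs; split => //; exact: interval_open.
    apply: filterS => s /=; rewrite in_itv/= => /andP[s0 s1]; apply: gh.
    by rewrite in_itv/= !ltW.
  by rewrite gh ?in_itv/= ?ltW// hr.
have hr' : {in `]0, 1[%classic : set R,
    (fun=> r%:E) =1 (fun t => cc_norm (h t) (derive1 h t))}.
  by move=> t _.
have bndoo f : {in `]0, 1[%classic : set R, (fun=> r%:E) =1 f} ->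
  (\int[lebesgue_measure]_(t in `[0%R, 1%R]) f t
   = \int[lebesgue_measure]_(t in `]0%R, 1%R[) r%:E)%E.
  move=> fr; rewrite integral_itv_bndoo; last first.
    exact: eq_measurable_fun fr (measurable_cst _).
  by apply: eq_integral => t t01; rewrite -fr.
by rewrite /cc_length !bndoo.
Qed.

Lemma rV1_collinear (F : fieldType) (n : nat) (y d : 'rV[F]_n) : n = 1%N ->
  y != 0 -> exists k, d = k *: y.
Proof.
move=> n1; move: y d; rewrite n1 => y d y0.
have y00 : y 0 0 != 0.
  apply: contra y0 => /eqP y00; apply/eqP/rowP => j.
  by rewrite ord1 y00 mxE.
by exists (d 0 0 / y 0 0); apply/rowP => j; rewrite ord1 mxE divfK.
Qed.

Section connecting_geodesics.
Variables (R : realType) (n : nat) (x : 'rV[R]_n) (u : R).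
Hypotheses (hx : x != 0) (hu : 0 < u).

Let G := geodesics (x, 0) (- x, u).
Let odd_pi (m : nat) : R := (2 * m + 1)%:R * pi.
Let norm_c (m : nat) : R :=
  Num.sqrt (2 * odd_pi m * u - odd_pi m ^+ 2 * enorm x ^+ 2).
Let a := u / enorm x ^+ 2.
Let a_gt0 : 0 < a := slope_gt0 hx hu.
Let x2 : 0 < enorm x ^+ 2 := enorm_sqr_gt0 hx.

Lemma odd_pi_gt0 m : 0 < odd_pi m.
Proof. by rewrite mulr_gt0 ?pi_gt0// ltr0n addn1. Qed.

Lemma odd_pi_ge m : pi <= odd_pi m.
Proof. by rewrite ler_peMl ?pi_ge0// ler1n addn1. Qed.

Lemma norm_c_sqr m : odd_pi m * enorm x ^+ 2 <= 2 * u ->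
  norm_c m ^+ 2 + odd_pi m ^+ 2 * enorm x ^+ 2 = 2 * odd_pi m * u.
Proof.
move=> mu; rewrite sqr_sqrtr ?subrK// subr_ge0.
have : odd_pi m * (odd_pi m * enorm x ^+ 2) <= odd_pi m * (2 * u).
  by rewrite ler_pM2l// odd_pi_gt0.
by rewrite mulrA -expr2; lra.
Qed.

Lemma gamma_cot_geodesic b : mu_solution x u b -> G (gamma_cot x b).
Proof.
move=> bsol; have b0 : b != 0 by rewrite gt_eqF// (mu_solution_gt0 hx hu bsol).
split; first exact: gamma_geodesic.
by split; [exact: gamma_0 | exact: gamma_cot_end].
Qed.

Lemma gamma_odd_geodesic m c : odd_pi m * enorm x ^+ 2 <= 2 * u ->
  enorm c = norm_c m -> G (gamma x (odd_pi m) c).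
Proof.
move=> mu cE; have b0 : odd_pi m != 0 by rewrite gt_eqF// odd_pi_gt0.
split; first exact: gamma_geodesic.
by split; [exact: gamma_0 | exact: gamma_odd_end].
Qed.

Lemma gamma_cot_cc_length b : mu_solution x u b ->
  cc_length (gamma_cot x b)
    = (Num.sqrt (b ^+ 2 / sin (b / 2) ^+ 2 * enorm x ^+ 2))%:E.
Proof.
move=> bsol; have b0 : b != 0 by rewrite gt_eqF// (mu_solution_gt0 hx hu bsol).
have /(mu_solutionP hx hu)[sb _] := bsol.
by rewrite cc_length_gamma// gamma_cot_length.
Qed.

Lemma gamma_odd_cc_length m c : odd_pi m * enorm x ^+ 2 <= 2 * u ->
  enorm c = norm_c m ->
  cc_length (gamma x (odd_pi m) c) = (Num.sqrt (2 * odd_pi m * u))%:E.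
Proof.
move=> mu cE; have b0 : odd_pi m != 0 by rewrite gt_eqF// odd_pi_gt0.
by rewrite cc_length_gamma// cE norm_c_sqr.
Qed.

Lemma sqr_length_ge0 b : 0 <= b ^+ 2 / sin (b / 2) ^+ 2 * enorm x ^+ 2.
Proof. by rewrite mulr_ge0 ?sqr_ge0// divr_ge0 ?sqr_ge0. Qed.

Lemma sqr_length_lt b1 b2 : mu_solution x u b1 -> mu_solution x u b2 -> b1 < b2 ->
  b1 ^+ 2 / sin (b1 / 2) ^+ 2 * enorm x ^+ 2
    < b2 ^+ 2 / sin (b2 / 2) ^+ 2 * enorm x ^+ 2.
Proof.
move=> /(mu_solutionP hx hu)[s1 r1] /(mu_solutionP hx hu)[s2 r2] b12.
rewrite ltr_pM2r//.
have E b : sin (b / 2) != 0 -> mu_root a (b / 2) ->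
    b ^+ 2 / sin (b / 2) ^+ 2 = 4 * (a * sin (b / 2) + cos (b / 2)) ^+ 2.
  by move=> sb rb; rewrite -mu_root_sqr//; field.
rewrite !E// ltr_pM2l//; apply: mu_root_lt => //.
by rewrite ltr_pM2r// invr_gt0.
Qed.

Lemma geodesics_classification g : G g -> exists (b : R) (c : 'rV[R]_n),
  eq01 g (gamma x b c) /\
  ((mu_solution x u b /\ c = - (b * cot (b / 2)) *: x) \/
   (exists m : nat, [/\ odd_pi m * enorm x ^+ 2 <= 2 * u,
                        b = odd_pi m & enorm c = norm_c m])).
Proof.
move=> [geog [g0 g1]].
have [|b [c [b0 gE]]] := geodesic_gamma geog g0.
  by rewrite g1 /= gt_eqF.
exists b, c; split => //; apply: (gamma_end hx hu b0).
by rewrite -gE// in_itv/= lexx ler01.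
Qed.

(** This constrains the given parameters, as counting the pairs requires; b = 0 is impossible
    because that curve stays at height 0. *)
Lemma gamma_classification b c : G (gamma x b c) ->
  (mu_solution x u b /\ c = - (b * cot (b / 2)) *: x) \/
  (exists m : nat, [/\ odd_pi m * enorm x ^+ 2 <= 2 * u,
                       b = odd_pi m & enorm c = norm_c m]).
Proof.
move=> [_ [_ g1]]; apply: (gamma_end hx hu) => //.
apply: contraTneq hu => b0; move: g1; rewrite b0 /gamma eqxx => -[_ <-].
by rewrite ltxx.
Qed.

Lemma finite_mu_solution : finite_set (mu_solution x u).
Proof.
apply: (@sub_finite_set _ _ ((fun s => 2 * s) @` mu_root a)); last first.
  by apply: finite_image; exact: finite_mu_root.
move=> b /(mu_solutionP hx hu)[_ rb]; exists (b / 2) => //.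
by field.
Qed.

Lemma finite_odd_pi : finite_set [set m | odd_pi m * enorm x ^+ 2 <= 2 * u].
Proof.
apply: (@sub_finite_set _ _ `I_(Num.truncn (2 * u / enorm x ^+ 2)).+1).
  move=> m /= mu; rewrite -(ltr_nat R); apply: le_lt_trans (truncnS_gt _).
  rewrite ler_pdivlMr//; apply: le_trans mu; rewrite ler_pM2r//.
  rewrite /odd_pi; have p2 := @pi_ge2 R; have m0 : 0 <= m%:R :> R by [].
  have -> : (2 * m + 1)%:R = 2 * m%:R + 1 :> R by rewrite natrD natrM.
  have : 0 <= m%:R * (pi - 2) :> R by rewrite mulr_ge0// subr_ge0.
  by lra.
exact: finite_II.
Qed.

Lemma finite_geodesic_parameters :
  finite_set [set (bc.1, enorm bc.2)
             | bc in [set bc : R * 'rV[R]_n | G (gamma x bc.1 bc.2)]].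
Proof.
apply: (@sub_finite_set _ _
    ((fun b => (b, enorm (- (b * cot (b / 2)) *: x))) @` mu_solution x u `|`
     (fun m => (odd_pi m, norm_c m)) @` [set m | odd_pi m * enorm x ^+ 2 <= 2 * u])).
  move=> _ [[b c] /= /gamma_classification[[bsol ->]|[m [mu -> ->]]] <-].
    by left; exists b.
  by right; exists m.
rewrite finite_setU; split; apply: finite_image.
  exact: finite_mu_solution.
exact: finite_odd_pi.
Qed.

(* In both cases an admissible c is one of the two multiples of x of the
   prescribed norm. *)
Lemma odd_pi_collinear m c : n = 1%N \/ 2 * u <= enorm x ^+ 2 * pi ->
  odd_pi m * enorm x ^+ 2 <= 2 * u -> enorm c = norm_c m ->
  exists e : bool, c = ((-1) ^+ e * (norm_c m / enorm x)) *: x.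
Proof.
have ex0 := enorm_neq0 hx.
move=> [n1|ux] mu cE.
  have [k ck] := rV1_collinear c n1 hx.
  exists (k < 0); rewrite -cE {1}ck ck enormZ mulfK//; congr (_ *: _).
  by rewrite -numEsign.
(* In pi |x|^2 <= [odd_pi m] |x|^2 <= 2 u <= pi |x|^2 equality holds throughout, so the sphere of
   admissible c shrinks to 0. *)
have cc0 : norm_c m = 0.
  have := odd_pi_ge m; rewrite -(ler_pM2r x2) => pm.
  have mE : odd_pi m * enorm x ^+ 2 = 2 * u by lra.
  rewrite /norm_c.
  have -> : 2 * odd_pi m * u - odd_pi m ^+ 2 * enorm x ^+ 2
      = odd_pi m * (2 * u - odd_pi m * enorm x ^+ 2) by ring.
  by rewrite mE subrr mulr0 sqrtr0.
exists false; rewrite cc0 mul0r mulr0 scale0r; apply: enorm_eq0.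
by rewrite cE.
Qed.

(** In the remaining case, n >= 2 and 2 u > pi |x|^2, the value m = 0 already admits a whole sphere
    of c. *)
Lemma finite_geodesics : n = 1%N \/ 2 * u <= enorm x ^+ 2 * pi ->
  finite_set [set (g \_ `[0%R, 1%R])%function | g in G].
Proof.
move=> hn.
pose gam (bc : R * 'rV[R]_n) := ((gamma x bc.1 bc.2) \_ `[0%R, 1%R])%function.
apply: (@sub_finite_set _ _
    (gam @` ((fun b => (b, - (b * cot (b / 2)) *: x)) @` mu_solution x u `|`
     (fun em : bool * nat =>
        (odd_pi em.2, ((-1) ^+ em.1 * (norm_c em.2 / enorm x)) *: x)) @`
       (setT `*` [set m | odd_pi m * enorm x ^+ 2 <= 2 * u])))).
  move=> _ [g Gg <-]; have [b [c [gE bc]]] := geodesics_classification Gg.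
  exists (b, c); last first.
    apply/funext => t; rewrite /gam !patchE; case: ifPn => // /set_mem t01.
    by rewrite gE.
  case: bc => [[bsol ->]|[m [mu -> cE]]]; first by left; exists b.
  have [e ->] := odd_pi_collinear hn mu cE.
  by right; exists (e, m).
apply: finite_image; rewrite finite_setU; split; apply: finite_image.
  exact: finite_mu_solution.
by apply: finite_setX; [exact: finite_finset | exact: finite_odd_pi].
Qed.

Lemma cc_dist_ge (b r : R) : 0 < b < pi -> 0 <= r ->
  r ^+ 2 <= 2 * b * u + 2 * enorm x ^+ 2 * b * cot (b / 2) ->
  (r%:E <= cc_dist (x, 0%R) (- x, u)%R)%E.
Proof.
move=> b0pi r0 rb; apply: le_ereal_inf_tmp => _ [g [hg xg] <-].
have := cc_length_ge0 g; case E : (cc_length g) => [l| |]//; last by move=> _; exact: leey.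
rewrite !lee_fin => l0.
rewrite -(ler_pXn2r (ltn0Sn 1)) ?nnegrE//; apply: le_trans rb _.
exact: (energy_le_sqr_length hg b0pi xg E).
Qed.

Lemma cc_dist_le_gamma b c : b != 0 -> gamma x b c 1 = (- x, u) ->
  (cc_dist (x, 0%R) (- x, u)%R <= cc_length (gamma x b c))%E.
Proof.
move=> b0 g1; apply: ereal_inf_lbound; exists (gamma x b c) => //.
by split; [exact: gamma_horizontal | split; [exact: gamma_0|]].
Qed.

Lemma cc_dist_large : enorm x ^+ 2 * pi <= 2 * u ->
  cc_dist (x, 0) (- x, u) = (Num.sqrt (2 * pi * u))%:E.
Proof.
move=> ux; have p0 := @pi_gt0 R.
have pi1 : odd_pi 0 = pi by rewrite /odd_pi muln0 add0n mul1r.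
have mu : odd_pi 0 * enorm x ^+ 2 <= 2 * u by rewrite pi1 mulrC.
apply/eqP; rewrite eq_le; apply/andP; split.
  pose c := (norm_c 0 / enorm x) *: x.
  have cE : enorm c = norm_c 0.
    rewrite enormZ ger0_norm ?divfK ?enorm_neq0//.
    by rewrite divr_ge0 ?sqrtr_ge0.
  have b0 : odd_pi 0 != 0 by rewrite gt_eqF// odd_pi_gt0.
  have := cc_dist_le_gamma b0 (gamma_odd_end mu cE).
  by rewrite gamma_odd_cc_length// pi1.
have sqrt_le b : 0 < b < pi -> ((Num.sqrt (2 * b * u))%:E <= cc_dist (x, 0%R) (- x, u)%R)%E.
  move=> bb; have /andP[b0 bpi] := bb; apply: (cc_dist_ge bb) => //.
  have cot0 : 0 <= cot (b / 2).
    by rewrite /cot divr_ge0 ?(ltW (cos_half_gt0 bb)) ?(ltW (sin_half_gt0 bb)).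
  rewrite sqr_sqrtr; first rewrite lerDl.
    exact: mulr_ge0 (mulr_ge0 (mulr_ge0 (ler0n _ 2) (ltW x2)) (ltW b0)) cot0.
  by rewrite !mulr_ge0 ?(ltW b0) ?(ltW hu).
have h0 : 0 < (pi / 2 : R) < pi by lra.
have := sqrt_le _ h0; case: (cc_dist _ _) sqrt_le => [l| |]// sqrt_le l0; last exact: leey.
have {}l0 : 0 <= l by rewrite -lee_fin; apply: le_trans l0; rewrite lee_fin sqrtr_ge0.
rewrite lee_fin leNgt; apply/negP => llt.
have l2 : l ^+ 2 < 2 * pi * u.
  have pu0 : 0 <= 2 * pi * u by rewrite !mulr_ge0 ?pi_ge0 ?(ltW hu).
  by rewrite -(sqr_sqrtr pu0) ltr_pXn2r ?nnegrE ?sqrtr_ge0.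
(* A distance l below sqrt(2 pi u) is refuted by the midpoint b between l^2 / (2 u) and pi, for
   which 2 b u > l^2. *)
pose b := (l ^+ 2 / (2 * u) + pi) / 2.
have lu : l ^+ 2 / (2 * u) < pi by rewrite ltr_pdivrMr ?mulr_gt0//; lra.
have lu0 : 0 <= l ^+ 2 / (2 * u) by rewrite divr_ge0 ?sqr_ge0// mulr_ge0// ltW.
have bpi : 0 < b < pi by rewrite /b; lra.
have := sqrt_le b bpi; rewrite lee_fin -(ler_pXn2r (ltn0Sn 1)) ?nnegrE ?sqrtr_ge0//.
have -> : Num.sqrt (2 * b * u) ^+ 2 = l ^+ 2 / 2 + pi * u.
  rewrite sqr_sqrtr; last first.
    have /andP[b0' _] := bpi.
    exact: mulr_ge0 (mulr_ge0 (ler0n _ 2) (ltW b0')) (ltW hu).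
  by rewrite /b; field; rewrite gt_eqF.
lra.
Qed.

Lemma cc_dist_small : 2 * u < enorm x ^+ 2 * pi ->
  exists b : R,
    [/\ 0 < b < pi /\ mu_solution x u b,
        forall b' : R, 0 < b' < pi -> mu_solution x u b' -> b' = b,
        G (gamma_cot x b) /\
          forall g, G g -> eq01 g (gamma_cot x b) \/
            (cc_length (gamma_cot x b) < cc_length g)%E,
        cc_dist (x, 0) (- x, u) = cc_length (gamma_cot x b) &
        cc_dist (x, 0) (- x, u) = (b / sin (b / 2) * enorm x)%:E /\
          b / sin (b / 2) * enorm x
            = Num.sqrt (2 * b * u + 2 * enorm x ^+ 2 * b * cot (b / 2))].
Proof.
move=> ux; have p0 := @pi_gt0 R.
have ap : a < pi / 2 by rewrite ltr_pdivrMr//; lra.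
have [s s0p sE] := mu_root_pihalf_exists a_gt0 ap.
pose b := 2 * s; have bs : b / 2 = s by rewrite /b; field.
have b0p : 0 < b < pi by rewrite /b; lra.
have [b0 bp] := andP b0p.
have sb : 0 < sin s by exact: sin_gt0_pihalf.
have bsol : mu_solution x u b.
  by apply/(mu_solutionP hx hu); rewrite bs gt_eqF.
have uniq b' : 0 < b' < pi -> mu_solution x u b' -> b' = b.
  move=> b'0p /(mu_solutionP hx hu)[_ b'E].
  have : b' / 2 = s by apply: (@mu_root_pihalf_uniq R a) => //; lra.
  by rewrite /b; lra.
have lenE : cc_length (gamma_cot x b) = (b / sin (b / 2) * enorm x)%:E.
  rewrite gamma_cot_cc_length// -expr_div_n -exprMn sqrtr_sqr ger0_norm//.
  by rewrite mulr_ge0 ?enorm_ge0// divr_ge0 ?bs// ltW.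
have len2 := mu_solution_length hx hu bsol.
have distE : cc_dist (x, 0) (- x, u) = cc_length (gamma_cot x b).
  apply/eqP; rewrite eq_le; apply/andP; split.
    by apply: cc_dist_le_gamma; [rewrite gt_eqF | exact: gamma_cot_end].
  rewrite lenE; apply: (cc_dist_ge b0p).
    by rewrite mulr_ge0 ?enorm_ge0// divr_ge0 ?bs// ltW.
  by rewrite -len2 exprMn expr_div_n.
exists b; split => //; last first.
  rewrite distE lenE; split => //; rewrite -len2 -expr_div_n -exprMn sqrtr_sqr.
  by rewrite ger0_norm// mulr_ge0 ?enorm_ge0// divr_ge0 ?bs// ltW.
split; first exact: gamma_cot_geodesic.
move=> g Gg; have [b' [c [gE [[b'sol cE]|[m [mu _ _]]]]]] := geodesics_classification Gg.
  rewrite cE in gE; have b'0 := mu_solution_gt0 hx hu b'sol.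
  (* Below pi the solution is unique; from pi on, monotonicity of the length makes the geodesic
     strictly longer. *)
  have [b'p|pb'] := ltP b' pi.
    by left; rewrite -(uniq b')// b'0.
  right; rewrite (eq01_cc_length gE (gamma_speed _ _ _)) ?gt_eqF//.
  rewrite -[gamma _ _ _]/(gamma_cot x b') !gamma_cot_cc_length// lte_fin.
  rewrite ltr_sqrt; first by apply: sqr_length_lt => //; exact: lt_le_trans pb'.
  apply: le_lt_trans (sqr_length_ge0 b) _.
  by apply: sqr_length_lt => //; exact: lt_le_trans pb'.
(* An odd multiple of pi would require 2 u >= pi |x|^2. *)
have := odd_pi_ge m; rewrite -(ler_pM2r x2) => pm.
by have := le_trans pm mu; rewrite mulrC leNgt ux.
Qed.

End connecting_geodesics.

Theorem theorem2p5 (R : realType) (n : nat) (x : 'rV[R]_n) (u : R)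
    (hx : x != 0) (hu : 0 < u) :
  let G := geodesics (x, 0) (- x, u) in
  let odd_pi (m : nat) : R := (2 * m + 1)%:R * pi in
  let norm_c (m : nat) : R :=
    Num.sqrt (2 * odd_pi m * u - odd_pi m ^+ 2 * enorm x ^+ 2) in
  (* finitely many: completeness of the list below, finiteness of the pairs
     (b, |c|), and of the set of curves where the sphere of admissible c is
     finite *)
  [/\ forall g, G g -> exists (b : R) (c : 'rV[R]_n),
        eq01 g (gamma x b c) /\
        ((mu_solution x u b /\ c = - (b * cot (b / 2)) *: x) \/
         (exists m : nat, [/\ odd_pi m * enorm x ^+ 2 <= 2 * u,
                              b = odd_pi m & enorm c = norm_c m])),
      finite_set [set (bc.1, enorm bc.2)
                 | bc in [set bc : R * 'rV[R]_n | G (gamma x bc.1 bc.2)]] &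
      (n = 1%N \/ 2 * u <= enorm x ^+ 2 * pi) ->
        finite_set [set (g \_ `[0%R, 1%R])%function | g in G]]
  /\
  [/\ forall b : R, mu_solution x u b ->
        [/\ G (gamma_cot x b),
            (cc_length (gamma_cot x b) ^+ 2
              = (b ^+ 2 / sin (b / 2) ^+ 2 * enorm x ^+ 2)%:E)%E &
            b ^+ 2 / sin (b / 2) ^+ 2 * enorm x ^+ 2
              = 2 * b * u + 2 * enorm x ^+ 2 * b * cot (b / 2)] &
      forall b1 b2 : R, mu_solution x u b1 -> mu_solution x u b2 -> b1 < b2 ->
        (cc_length (gamma_cot x b1) ^+ 2 < cc_length (gamma_cot x b2) ^+ 2)%E]
  /\
  (enorm x ^+ 2 * pi <= 2 * u ->
     forall m : nat, odd_pi m * enorm x ^+ 2 <= 2 * u ->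
       (exists c : 'rV[R]_n, enorm c = norm_c m) /\
       (forall c : 'rV[R]_n, enorm c = norm_c m ->
          G (gamma x (odd_pi m) c) /\
          cc_length (gamma x (odd_pi m) c)
            = (Num.sqrt (2 * odd_pi m * u))%:E))
  /\
  (2 * u < enorm x ^+ 2 * pi ->
     exists b : R,
       [/\ 0 < b < pi /\ mu_solution x u b,
           forall b' : R, 0 < b' < pi -> mu_solution x u b' -> b' = b,
           G (gamma_cot x b) /\
             forall g, G g -> eq01 g (gamma_cot x b) \/
               (cc_length (gamma_cot x b) < cc_length g)%E,
           cc_dist (x, 0) (- x, u) = cc_length (gamma_cot x b) &
           cc_dist (x, 0) (- x, u) = (b / sin (b / 2) * enorm x)%:E /\
             b / sin (b / 2) * enorm x
               = Num.sqrt (2 * b * u + 2 * enorm x ^+ 2 * b * cot (b / 2))])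
  /\
  (enorm x ^+ 2 * pi <= 2 * u ->
     cc_dist (x, 0) (- x, u) = (Num.sqrt (2 * pi * u))%:E).
Proof.
move=> G odd_pi norm_c.
split; [split | split; [split | split; [|split]]].
- by move=> g; exact: geodesics_classification.
- exact: finite_geodesic_parameters.
- exact: finite_geodesics.
- move=> b bsol; split.
  + exact: gamma_cot_geodesic.
  + rewrite (gamma_cot_cc_length hx hu)// -EFin_expe sqr_sqrtr//.
    exact: sqr_length_ge0.
  + exact: mu_solution_length.
- move=> b1 b2 b1sol b2sol b12; rewrite !(gamma_cot_cc_length hx hu)// -!EFin_expe.
  rewrite lte_fin !(sqr_sqrtr (sqr_length_ge0 _ _)).
  exact: (sqr_length_lt hx hu).
- move=> _ m mu; split.
    exists ((norm_c m / enorm x) *: x).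
    by rewrite enormZ ger0_norm ?divfK ?enorm_neq0// divr_ge0 ?sqrtr_ge0.
  move=> c cE; split; first exact: gamma_odd_geodesic.
  exact: gamma_odd_cc_length.
- exact: cc_dist_small.
- exact: cc_dist_large.
Qed.
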